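(* Let $H\subset \mathrm{Aut}(\mathbb{A}^2)$ be a subgroup and let $p\in\mathbb{A}^2(\overline{\Bbbk})$ be such that $\mathcal C=\overline{\mathrm{O}_H(p)}$ is an irreducible curve. Put $A=\mathrm{Aut}(\mathbb{A}^2,\mathrm{O}_H(p))$, $G=\mathrm{Aut}(\mathbb{A}^2,\mathcal C)$, and let $G_p$ be the isotropy group of $p$ in $G$. With $T$, $\tau_p$, $R$ as defined in the context, and $H_0=H\cap T$, $A_0=A\cap T$ when $\mathcal C$ is of type (3), (4) or (5), the following hold. (a) If $\mathcal C$ is a curve of type (1) or (2), then $A=H$. (b) If $\mathcal C$ is a curve of type (3), (4) or (5), then $G_p=\{\mathrm{Id},\tau_p\}\cong\mathbb{Z}_2$ and: (i) If $H=H_0\subset T$, then $A=H_0\cup H_0\tau_p=H_0\rtimes G_p$. (ii) If $H=H_0\rtimes G_p=H_0\cup H_0\tau_p$, then $A=H$. (iii) If $H=H_0\rtimes\{\mathrm{Id},t_0\tau_p\}=H_0\cup H_0t_0\tau_p$ with $t_0\in T$, $t_0\notin H_0$, then $A=H$ unless $t_0^2\in H_0$, in which case $$A=\langle H_0\cup\{t_0\}\rangle\cup\langle H_0\cup\{t_0\}\rangle t_0\tau_p=\langle H_0\cup\{t_0\}\rangle\rtimes\{\mathrm{Id},t_0\tau_p\};$$ in particular, $A_0=\langle H_0\cup\{t_0\}\rangle$ and $A_0/H_0\cong\mathbb{Z}_2$. (c) If $\mathcal C$ is a curve of type (6), then $A=H(G_p\cap A)$. In particular, $H\,\mathrm{Ker}(R)\subset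 A$.
   Context: $\Bbbk$ is a perfect field with algebraic closure $\overline{\Bbbk}$. $\mathbb{A}^2=\mathrm{Spec}(\Bbbk[x,y])$, with $\overline{\Bbbk}$-points $\mathbb{A}^2(\overline{\Bbbk})$. $\mathrm{Aut}(\mathbb{A}^2)$ is the abstract group of $\Bbbk$-automorphisms of $\mathbb{A}^2$; an element is written as a pair $(f,g)$ of polynomials in $\Bbbk[x,y]$ and acts on $\mathbb{A}^2(\overline{\Bbbk})$ by $p\mapsto (f(p),g(p))$. For $\Delta\subset\mathbb{A}^2(\overline{\Bbbk})$, $\mathrm{Aut}(\mathbb{A}^2,\Delta)$ is the stabilizer of the set $\Delta$ in $\mathrm{Aut}(\mathbb{A}^2)$ and $\overline{\Delta}$ is the Zariski closure of $\Delta$ in $\mathbb{A}^2(\overline{\Bbbk})$. $\mathrm{O}_H(p)=\{h(p): h\in H\}$. For subsets $X,Y$ of a group, $XY=\{xy: x\in X,y\in Y\}$, and $\langle X\rangle$ is the subgroup generated by $X$. Types of curves. A subset $D\subset\mathbb{A}^2(\overline{\Bbbk})$ is a curve of type $(n)$, $1\le n\le 6$, if up to applying an element of $\mathrm{Aut}(\mathbb{A}^2)$ it is the set of $\overline{\Bbbk}$-points of one of the following curves (its canonical form): (1) $x^b-\lambda y^a=0$, with $a,b>1$ coprime integers, $\lambda\in\Bbbk^*$; (2) $x^by^a-\lambda=0$, with $a,b\ge1$ coprime integers, $ab\ne1$, $\lambda\in\Bbbk^*$; (3) $xy-\lambda=0$, $\lambda\in\Bbbk^*$; (4) $\lambda x^2+\nu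 y^2-1=0$, where $\mathrm{char}(\Bbbk)\ne2$ and $\lambda,\nu\in\Bbbk^*$ are such that $-\lambda\nu$ is not a square in $\Bbbk$; (5) $x^2+\mu xy+y^2-1=0$, where $\mathrm{char}(\Bbbk)=2$ and $\mu\in\Bbbk^*$ is such that $x^2+\mu x+1$ has no root in $\Bbbk$; (6) the line $x=0$. The torus $T$ (types (3)–(5)). For the canonical form, $T$ is the following subgroup of $\mathrm{Aut}(\mathbb{A}^2,\mathcal C)$: in type (3), $T=\{(tx,t^{-1}y): t\in\Bbbk^*\}$; in type (4), $T=T_{\lambda,\nu}$ is the group of matrices $t_{a,b}=\left(\begin{smallmatrix} a&-\nu b\\ \lambda b&a\end{smallmatrix}\right)$ with $a,b\in\Bbbk$, $a^2+\lambda\nu b^2=1$; in type (5), $T=T_\mu$ is the group of matrices $t_{a,b}=\left(\begin{smallmatrix} a&b\\ b&a+\mu b\end{smallmatrix}\right)$ with $a,b\in\Bbbk$, $a^2+\mu ab+b^2=1$. The involution $\tau_p$ (types (3)–(5)). For the canonical form and $p=(x_p,y_p)\in\mathcal C$: in type (3), $\tau_p(x,y)=\left(\frac{x_p}{y_p}y,\frac{y_p}{x_p}x\right)$; in type (4), $\tau_p=t_{2\lambda x_p^2-1,\,2x_py_p}\tau$ with $\tau(x,y)=(x,-y)$; in type (5), $\tau_p=t_{x_p^2+y_p^2,\,\mu y_p^2}\sigma_\mu$ with $\sigma_\mu(x,y)=(x+\mu y,y)$. If $\mathcal C$ is not in canonical form, $T$ and $\tau_p$ are obtained by conjugating with an element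 of $\mathrm{Aut}(\mathbb{A}^2)$ that carries $\mathcal C$ to its canonical form. For type (6), $R:\mathrm{Aut}(\mathbb{A}^2,\mathcal C)\to\mathrm{Aut}(\mathcal C)$ is the restriction map; for the line $x=0$, $\mathrm{Ker}(R)=\{(ax,y+P(x)): a\in\Bbbk^*, P\in\Bbbk[x], P(0)=0\}$.
   Formalization: In (b), τ_p is additionally required to have coefficients in 𝕜, i.e. to be an element of Aut(A²); without this (b) fails, e.g. 𝕜=ℚ, H=T, p=(2^{1/4},2^{-1/4}) on xy=1, where G_p={Id} and A=H. *)

(* Defs.v *)
From HB Require Import structures.
From mathcomp Require Import all_boot all_order all_algebra separable.
From mathcomp Require Import boolp classical_sets.
From mathcomp Require Import mpoly.

Set Implicit Arguments.
Unset Strict Implicit.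
Unset Printing Implicit Defensive.

Import GRing.Theory.
Local Open Scope classical_set_scope.
Local Open Scope ring_scope.

Definition perfect_field (k : fieldType) : Prop :=
  forall q : {poly k}, irreducible_poly q -> separable_poly q.

Definition is_algebraic_closure (k : fieldType) (L : closedFieldType)
  (iota : {rmorphism k -> L}) : Prop := forall z : L, algebraicOver iota z.

Section PolynomialMaps.
Variable k : fieldType.

Definition polymap : Type := ({mpoly k[2]} * {mpoly k[2]})%type.

Definition varx : {mpoly k[2]} := 'X_(0 : 'I_2).
Definition vary : {mpoly k[2]} := 'X_(1 : 'I_2).

Definition pid : polymap := (varx, vary).

(* [pcomp F G] is the map q |-> F(G(q)). *)
Definition pcomp (F G : polymap) : polymap :=
  (F.1 \mPo [tuple G.1; G.2], F.2 \mPo [tuple G.1; G.2]).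

Lemma comp_mpoly_pcomp (f : {mpoly k[2]}) (F G : polymap) :
  (f \mPo [tuple F.1; F.2]) \mPo [tuple G.1; G.2] =
  f \mPo [tuple (pcomp F G).1; (pcomp F G).2].
Proof.
rewrite [f \mPo [tuple F.1; F.2]]comp_mpolyEX.
rewrite [RHS]comp_mpolyEX raddf_sum /=; apply: eq_bigr => m _.
rewrite comp_mpolyZ; congr (_ *: _); rewrite !comp_mpolyX rmorph_prod /=.
apply: eq_bigr => i _; rewrite rmorphXn /=; congr (_ ^+ _).
by rewrite !(tnth_nth 0); case: i => [[|[|]]].
Qed.

Lemma pcompA : associative pcomp.
Proof. by move=> F G E; rewrite {1 3}/pcomp !comp_mpoly_pcomp. Qed.

Lemma pcompid F : pcomp F pid = F.
Proof.
have e : [tuple pid.1; pid.2] = [tuple 'X_i | i < 2] :> 2.-tuple {mpoly k[2]}.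
  apply: eq_from_tnth => i; rewrite tnth_mktuple (tnth_nth 0).
  by case: i => [[|[|]]] //= ?; congr 'X_ _; apply: val_inj.
by rewrite /pcomp e !comp_mpoly_id -surjective_pairing.
Qed.

Lemma pidcomp F : pcomp pid F = F.
Proof. by rewrite /pcomp !comp_mpolyXU -surjective_pairing. Qed.

(* An automorphism is a pair (f, g) of polynomials bundled with its inverse
   pair; the inverse being unique, this adds no data. *)
Definition aut : Type := {FG : polymap * polymap |
  (pcomp FG.1 FG.2 == pid) && (pcomp FG.2 FG.1 == pid)}.

HB.instance Definition _ := Choice.on aut.

Definition polymap_of_aut (g : aut) : polymap := (val g).1.
Coercion polymap_of_aut : aut >-> polymap.

Lemma aut_inj (g h : aut) : g = h :> polymap -> g = h.
Proof.
case: g h => [[F F'] /= FP] [[E E'] /= EP]; rewrite /polymap_of_aut /= => eFE.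
apply: val_inj => /=; rewrite -eFE in EP *; congr (_, _).
case/andP: FP => _ /eqP F'F; case/andP: EP => /eqP FE' _.
by rewrite -[LHS]pcompid -FE' pcompA F'F pidcomp.
Qed.

Fact one_autP : (pcomp pid pid == pid) && (pcomp pid pid == pid).
Proof. by rewrite pcompid eqxx. Qed.
Definition one_aut : aut := exist _ (pid, pid) one_autP.

Fact inv_autP (g : aut) :
  (pcomp (val g).2 (val g).1 == pid) && (pcomp (val g).1 (val g).2 == pid).
Proof. by rewrite andbC (valP g). Qed.
Definition inv_aut (g : aut) : aut :=
  exist _ ((val g).2, (val g).1) (inv_autP g).

Fact mul_autP (g h : aut) (F := pcomp g h)
  (E := pcomp (inv_aut h) (inv_aut g)) :
  (pcomp F E == pid) && (pcomp E F == pid).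
Proof.
rewrite {}/F {}/E; case: g h => [[F F'] /= FP] [[E E'] /= EP].
rewrite /polymap_of_aut /=.
case/andP: FP EP => /eqP FF' /eqP F'F /andP[/eqP EE' /eqP E'E].
rewrite pcompA -[pcomp (pcomp F E) E']pcompA EE' pcompid FF' eqxx.
by rewrite pcompA -[pcomp (pcomp E' F') F]pcompA F'F pcompid E'E eqxx.
Qed.
Definition mul_aut (g h : aut) : aut :=
  exist _ (pcomp g h, pcomp (inv_aut h) (inv_aut g)) (mul_autP g h).

Fact mul_autA : associative mul_aut.
Proof. by move=> g h i; apply: aut_inj; apply: pcompA. Qed.
Fact mul_1aut : left_id one_aut mul_aut.
Proof. by move=> g; apply: aut_inj; apply: pidcomp. Qed.
Fact mul_aut1 : right_id one_aut mul_aut.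
Proof. by move=> g; apply: aut_inj; apply: pcompid. Qed.
Fact mul_Vaut : left_inverse one_aut inv_aut mul_aut.
Proof. by move=> g; apply: aut_inj; case/andP: (valP g) => _ /eqP. Qed.
Fact mul_autV : right_inverse one_aut inv_aut mul_aut.
Proof. by move=> g; apply: aut_inj; case/andP: (valP g) => /eqP. Qed.

HB.instance Definition _ := isGroup.Build aut
  mul_autA mul_1aut mul_aut1 mul_Vaut mul_autV.

End PolynomialMaps.

Section Groups.
Variable gT : groupType.
Implicit Types X Y H K N : set gT.
Local Open Scope group_scope.

Definition is_subgroup H : Prop :=
  [/\ H 1, forall x y, H x -> H y -> H (x * y) & forall x, H x -> H x^-1].

Definition generated X : set gT := smallest is_subgroup X.

Definition mulset X Y : set gT := [set x * y | x in X & y in Y].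

Definition is_normal_in N K : Prop :=
  [/\ is_subgroup N, is_subgroup K, N `<=` K &
      forall x n, K x -> N n -> N (x * n * x^-1)].

Definition is_sdprod K N H : Prop :=
  [/\ is_normal_in N K, is_subgroup H, H `<=` K,
      N `&` H = [set 1] & K = mulset N H].

Definition cosets K N : set (set gT) := [set [set x * n | n in N] | x in K].

End Groups.

Definition isog_Z2 (M : Type) (op : M -> M -> M) (S : set M) : Prop :=
  exists f : 'Z_2 -> M,
    [/\ injective f, range f = S & forall a b, f (a + b) = op (f a) (f b)].

Definition quotient_isog_Z2 (gT : groupType) (K N : set gT) : Prop :=
  is_normal_in N K /\ isog_Z2 (@mulset gT) (cosets K N).

Section Points.
Variables (k : fieldType) (L : closedFieldType) (iota : {rmorphism k -> L}).

Definition peval (f : {mpoly L[2]}) (q : L * L) : L :=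
  f.@[tnth [tuple q.1; q.2]].

Definition zeros (f : {mpoly L[2]}) : set (L * L) := [set q | peval f q = 0].

Definition zariski_closure (D : set (L * L)) : set (L * L) :=
  [set q | forall f : {mpoly L[2]}, D `<=` zeros f -> peval f q = 0].

Definition zariski_closed (D : set (L * L)) : Prop := zariski_closure D = D.

Definition zariski_irreducible (D : set (L * L)) : Prop :=
  D !=set0 /\
  forall D1 D2, zariski_closed D1 -> zariski_closed D2 ->
    D `<=` D1 `|` D2 -> D `<=` D1 \/ D `<=` D2.

(* [1 < msize f] means that f is not constant. *)
Definition irreducible_curve (C : set (L * L)) : Prop :=
  (exists2 f : {mpoly L[2]}, (1 < msize f)%N & C = zeros f) /\
  zariski_irreducible C.

Definition act (g : aut k) (q : L * L) : L * L :=
  (peval (map_mpoly iota (polymap_of_aut g).1) q,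
   peval (map_mpoly iota (polymap_of_aut g).2) q).

Definition orbit_of (H : set (aut k)) (q : L * L) : set (L * L) :=
  [set act h q | h in H].

Definition set_stabilizer (D : set (L * L)) : set (aut k) :=
  [set g | act g @` D = D].

Definition isotropy (G : set (aut k)) (q : L * L) : set (aut k) :=
  [set g | G g /\ act g q = q].

(* Ker(R), for R the restriction map Aut(A^2, C) -> Aut(C). *)
Definition ker_restriction (C : set (L * L)) : set (aut k) :=
  [set g | set_stabilizer C g /\ forall q, C q -> act g q = q].

Local Notation x := (varx k).
Local Notation y := (vary k).

Definition kcurve (f : {mpoly k[2]}) : set (L * L) := zeros (map_mpoly iota f).

Definition carries (phi : aut k) (C : set (L * L)) (f : {mpoly k[2]}) : Prop :=
  act phi @` C = kcurve f.

Definition type1 (C : set (L * L)) : Prop :=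
  exists (phi : aut k) (a b : nat) (lam : k),
    [/\ (1 < a)%N, (1 < b)%N, coprime a b, lam != 0 &
        carries phi C (x ^+ b - lam *: y ^+ a)].

Definition type2 (C : set (L * L)) : Prop :=
  exists (phi : aut k) (a b : nat) (lam : k),
    [/\ [&& 0 < a, 0 < b & a * b != 1]%N, coprime a b, lam != 0 &
        carries phi C (x ^+ b * y ^+ a - lam%:MP)].

Definition type6 (C : set (L * L)) : Prop :=
  exists phi : aut k, carries phi C x.

Variant conic :=
  | Conic3 (lam : k)
  | Conic4 (lam nu : k)
  | Conic5 (mu : k).

Definition conic_valid (c : conic) : Prop :=
  match c with
  | Conic3 lam => lam != 0
  | Conic4 lam nu =>
      [/\ 2%N \notin [pchar k], lam != 0, nu != 0 &
          forall z : k, z ^+ 2 != - (lam * nu)]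
  | Conic5 mu =>
      [/\ 2%N \in [pchar k], mu != 0 &
          forall z : k, z ^+ 2 + mu * z + 1 != 0]
  end.

Definition conic_eqn (c : conic) : {mpoly k[2]} :=
  match c with
  | Conic3 lam => x * y - lam%:MP
  | Conic4 lam nu => lam *: x ^+ 2 + nu *: y ^+ 2 - 1
  | Conic5 mu => x ^+ 2 + mu *: (x * y) + y ^+ 2 - 1
  end.

(* Matrices act on column vectors (x, y). *)
Definition linmap (a b c d : k) : polymap k :=
  (a *: x + b *: y, c *: x + d *: y).

Definition tmat4 (lam nu a b : k) : polymap k :=
  linmap a (- (nu * b)) (lam * b) a.

Definition tmat5 (mu a b : k) : polymap k := linmap a b b (a + mu * b).

Definition conic_torus (c : conic) : set (aut k) :=
  match c with
  | Conic3 _ =>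
      [set g | exists2 t : k, t != 0 &
                 polymap_of_aut g = (t *: x, t^-1 *: y)]
  | Conic4 lam nu =>
      [set g | exists a b : k, a ^+ 2 + lam * nu * b ^+ 2 = 1 /\
                 polymap_of_aut g = tmat4 lam nu a b]
  | Conic5 mu =>
      [set g | exists a b : k, a ^+ 2 + mu * a * b + b ^+ 2 = 1 /\
                 polymap_of_aut g = tmat5 mu a b]
  end.

(* [g] is the involution tau_q of the conic.  Its coefficients are expressions
   in the coordinates of q, a point over the algebraic closure, so tau_q is an
   automorphism over k only if they come from k: hence the equations on iota. *)
Definition is_conic_tau (c : conic) (q : L * L) (g : aut k) : Prop :=
  match c with
  | Conic3 _ =>
      exists s : k, iota s = q.1 / q.2 /\
        polymap_of_aut g = (s *: y, s^-1 *: x)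
  | Conic4 lam nu =>
      exists a b : k,
        [/\ iota a = 2%:R * iota lam * q.1 ^+ 2 - 1,
            iota b = 2%:R * q.1 * q.2 &
            polymap_of_aut g = pcomp (tmat4 lam nu a b) (x, - y)]
  | Conic5 mu =>
      exists a b : k,
        [/\ iota a = q.1 ^+ 2 + q.2 ^+ 2,
            iota b = iota mu * q.2 ^+ 2 &
            polymap_of_aut g = pcomp (tmat5 mu a b) (x + mu *: y, y)]
  end.

End Points.

(* Main.v *)
Require Import Defs.
From HB Require Import structures.
From mathcomp Require Import all_boot all_order all_algebra.
From mathcomp Require Import boolp classical_sets.
From mathcomp Require Import mpoly.
From mathcomp Require Import ring zify.

Set Implicit Arguments.
Unset Strict Implicit.
Unset Printing Implicit Defensive.

Import GRing.Theory.
Local Open Scope classical_set_scope.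
Local Open Scope ring_scope.

(** Let O be the orbit of p, so that A is the stabilizer of O.  For g in A the
    point g p is h p for some h in H, and then h^-1 g is an element of A that
    fixes p.  Automorphisms are homeomorphisms for the Zariski topology, so A
    is contained in G and h^-1 g lies in G_p.  Thus A = H (G_p ∩ A), which is
    the content of (c), and in the other cases everything follows from the
    description of G_p ([stabilizer_orbit_coset], [stabilizer_closure]).

    The group G_p is determined over L.  If f generates the ideal of its zero
    set and the plane automorphism F preserves that set, then F multiplies f by
    a nonzero constant ([pullback_semi_invariant]).  The binomials that define
    the curves of types (1), (2) and (3) generate the ideals of their zero sets
    because division by them leaves only monomials that take different
    exponents under a monomial parametrization ([cusp_ideal],
    [hyperbola_ideal]).  With F = (F1, F2) the semi-invariance is a polynomial
    identity in F1 and F2: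

    - for x^b y^a = lam it forces F1^b F2^a = x^b y^a, and hence F1 and F2 are
      multiples of x and y, or of y and x when a = b
      ([hyperbola_stabilizer]);
    - for x^b = lam y^a with a, b > 1, differentiating
      F1^b - lam F2^a = gam (x^b - lam y^a) and using that the Jacobian
      determinant is constant bounds the degrees of F1 and F2 for the weights
      (a, b) of x and y by a and b, and shows that the singular point is fixed;
      then F is diagonal ([cusp_degrees], [cusp_stabilizer]).

    A diagonal automorphism that fixes a point off the axes is the identity, so
    G_p = 1 for types (1) and (2).  For type (1) the point p is not the singular
    point, since that one is fixed by all of H and its orbit is not dense.

    A conic of type (4) or (5) is u v = lam over L for two linear forms u and v;
    in these coordinates the torus acts by (u, v) -> (s u, s^-1 v) and tau_p is
    the map (u, v) -> (s v, s^-1 u) with s = u(p) / v(p) ([conic_splits]).  By the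
    case a = b = 1 of the hyperbola every element of G has one of these two
    forms, so G_p = {1, tau_p} ([conic_isotropy]).  The rest of (b) is
    a computation in a group where T is commutative, acts freely on the orbit
    of p, and is inverted by tau_p ([torus_extension]). *)

(** * Polynomials in two variables and their values *)

Section TwoVariables.
Variable R : fieldType.
Implicit Types (h : {mpoly R[2]}) (m : 'X_{1..2}).

Lemma big_ord2 (T : Type) (idx : T) (op : Monoid.law idx) (F : 'I_2 -> T) :
  \big[op/idx]_(i < 2) F i = op (F 0) (F 1).
Proof.
by rewrite big_ord_recl big_ord1; congr (op (F _) (F _)); apply: val_inj.
Qed.

Lemma mnm2P m m' : m 0 = m' 0 -> m 1 = m' 1 -> m = m'.
Proof.
move=> e0 e1; apply/mnmP; case=> [[|[|//]]] lti.
  by rewrite [Ordinal _](_ : _ = 0) //; apply: val_inj.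
by rewrite [Ordinal _](_ : _ = 1) //; apply: val_inj.
Qed.

Lemma mpolyX_xy m : 'X_[m] = varx R ^+ m 0 * vary R ^+ m 1.
Proof. by rewrite mpolyXE_id big_ord2. Qed.

(** Reduces identities between algebraic operations, such as the chain rule, to
    constants and the two variables. *)
Lemma mpoly_alg_ind (P : {mpoly R[2]} -> Prop) :
  (forall c, P c%:MP) -> P (varx R) -> P (vary R) ->
  (forall f g, P f -> P g -> P (f + g)) ->
  (forall f g, P f -> P g -> P (f * g)) -> forall f, P f.
Proof.
move=> Pc Px Py PD PM f.
have PX g i : P g -> P (g ^+ i).
  move=> Pg; elim: i => [|i IH]; first exact: (Pc 1).
  by rewrite exprS; apply: PM.
rewrite [f]mpolyE; elim: (msupp f : seq _) => [|m s IH].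
  by rewrite big_nil; apply: (Pc 0).
rewrite big_cons; apply: PD => //; rewrite -mul_mpolyC mpolyX_xy.
by apply: (PM) => //; apply: (PM); apply: PX.
Qed.

Lemma peval_sum (L : closedFieldType) (f : {mpoly L[2]}) q :
  peval f q = \sum_(m <- msupp f) f@_m * (q.1 ^+ m 0 * q.2 ^+ m 1).
Proof. by rewrite /peval mevalE; apply: eq_bigr => m _; rewrite big_ord2. Qed.

End TwoVariables.

Section Evaluation.
Variable L : closedFieldType.
Implicit Types (f g : {mpoly L[2]}) (q : L * L).

Lemma pevalD f g q : peval (f + g) q = peval f q + peval g q.
Proof. exact: mevalD. Qed.
Lemma pevalB f g q : peval (f - g) q = peval f q - peval g q.
Proof. exact: mevalB. Qed.
Lemma pevalN f q : peval (- f) q = - peval f q.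
Proof. exact: mevalN. Qed.
Lemma pevalM f g q : peval (f * g) q = peval f q * peval g q.
Proof. exact: mevalM. Qed.
Lemma pevalXn f n q : peval (f ^+ n) q = peval f q ^+ n.
Proof. exact: rmorphXn. Qed.
Lemma pevalZ c f q : peval (c *: f) q = c * peval f q.
Proof. exact: mevalZ. Qed.
Lemma pevalC c q : peval c%:MP q = c.
Proof. exact: mevalC. Qed.
Lemma peval1 q : peval 1 q = 1.
Proof. exact: meval1. Qed.
Lemma pevalx q : peval (varx L) q = q.1.
Proof. by rewrite /peval mevalXU. Qed.
Lemma pevaly q : peval (vary L) q = q.2.
Proof. by rewrite /peval mevalXU. Qed.

Definition pevalE := (pevalD, pevalB, pevalN, pevalM, pevalXn, pevalZ, pevalC,
  peval1, pevalx, pevaly).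

Definition pact (F : polymap L) q : L * L := (peval F.1 q, peval F.2 q).

Lemma peval_comp f (F : polymap L) q :
  peval (f \mPo [tuple F.1; F.2]) q = peval f (pact F q).
Proof.
rewrite /peval comp_mpoly_meval; apply: meval_eq.
by case=> [[|[|]]].
Qed.

(** The sum is the value at t of a polynomial in one variable that vanishes at
    all nonzero points, hence is zero. As [e] is injective, no two monomials of
    [r] are merged by the substitution, so its coefficients can be read off
    from those of that polynomial. *)
Lemma monomial_substitution_eq0 (r : {mpoly L[2]}) (c : 'X_{1..2} -> L)
    (e : 'X_{1..2} -> nat) :
  (forall m, c m != 0) -> {in msupp r &, injective e} ->
  (forall t, t != 0 ->
     \sum_(m <- msupp r) r@_m * (c m * t ^+ e m) = 0) -> r = 0.
Proof.
move=> c0 e_inj r0.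
pose P : {poly L} := \sum_(m <- msupp r) (r@_m * c m) *: 'X^(e m).
have P0 : P = 0.
  apply/eqP; apply: contraT => nzP.
  have /closed_nonrootP[t] : 'X * P != 0 by rewrite mulf_neq0 ?polyX_eq0.
  rewrite rootM negb_or !rootE hornerX => /andP[t0 /eqP[]].
  rewrite /P horner_sum -[RHS](r0 t t0); apply: eq_bigr => m _.
  by rewrite hornerZ hornerXn mulrA.
apply/mpolyP => m; rewrite mcoeff0; have [rm|] := boolP (m \in msupp r);
  last by move/memN_msupp_eq0.
have : P`_(e m) = 0 by rewrite P0 coef0.
rewrite /P coef_sum (bigD1_seq m) ?msupp_uniq //= coefZ coefXn eqxx mulr1.
rewrite big1_seq ?addr0 => [/eqP|m' /andP[m'm rm']].
  by rewrite mulf_eq0 (negbTE (c0 m)) orbF => /eqP.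
rewrite coefZ coefXn; case: eqP => [/e_inj|]; last by rewrite mulr0.
by move=> /(_ rm rm') mm'; rewrite mm' eqxx in m'm.
Qed.

(** Makes it possible to verify identities between automorphisms on points. *)
Lemma peval_inj f g : (forall q, peval f q = peval g q) -> f = g.
Proof.
move=> fg; apply/eqP; rewrite -subr_eq0; apply/eqP; set r := f - g.
(* Kronecker substitution: x = t, y = t ^ N with N larger than the degree. *)
pose N := msize r.
apply: (@monomial_substitution_eq0 r (fun=> 1) (fun m => m 0%R + N * m 1%R)%N).
- by move=> m; apply: oner_neq0.
- move=> m m' rm rm' /= e.
  have lt0 m1 : m1 \in msupp r -> (m1 0%R < N)%N.
    by move/msize_mdeg_lt; apply: leq_ltn_trans; rewrite mdegE big_ord2 leq_addr.
  have N0 : (0 < N)%N by apply: leq_ltn_trans (lt0 m rm).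
  have e0 : m 0 = m' 0.
    have := congr1 (modn^~ N) e; rewrite /= ![(N * _)%N]mulnC ![(_ + _ * N)%N]addnC.
    by rewrite !modnMDl !modn_small ?lt0.
  apply: (mnm2P e0); move/eqP: e; rewrite e0 eqn_add2l eqn_pmul2l //.
  by move/eqP.
move=> t t0; have := pevalB f g (t, t ^+ N); rewrite fg subrr peval_sum /=.
by move=> {2}<-; apply: eq_bigr => m _; rewrite mul1r exprD exprM.
Qed.

Lemma pact_inj (F G : polymap L) : (forall q, pact F q = pact G q) -> F = G.
Proof.
move=> FG; rewrite [F]surjective_pairing [G]surjective_pairing.
by congr (_, _); apply: peval_inj => q; case: (FG q).
Qed.

Lemma pact_comp F G q : pact (Defs.pcomp F G) q = pact F (pact G q).
Proof. by rewrite /pact /= !peval_comp. Qed.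

Lemma pact_id q : pact (pid L) q = q.
Proof. by rewrite /pact /= pevalx pevaly -surjective_pairing. Qed.

End Evaluation.

(** * Automorphisms over k as automorphisms over L *)

Section BaseChange.
Variables (k : fieldType) (L : closedFieldType) (iota : {rmorphism k -> L}).

Definition base_change_map (F : polymap k) : polymap L :=
  (map_mpoly iota F.1, map_mpoly iota F.2).

Lemma base_change_map_comp F G : base_change_map (Defs.pcomp F G) =
  Defs.pcomp (base_change_map F) (base_change_map G).
Proof.
rewrite /base_change_map /Defs.pcomp /= !map_mpoly_comp; try exact: fmorph_inj.
by congr pair; congr comp_mpoly; apply: val_inj.
Qed.

Lemma base_change_map_id : base_change_map (pid k) = pid L.
Proof. by rewrite /base_change_map /= !map_mpolyX. Qed.

Lemma base_change_map_inj : injective base_change_map.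
Proof.
have map_inj : injective (map_mpoly (n := 2) iota).
  move=> f g /mpolyP fg; apply/mpolyP => m; apply: (fmorph_inj iota).
  by rewrite -!mcoeff_map_mpoly fg.
by case=> [f1 f2] [g1 g2] [/map_inj -> /map_inj ->].
Qed.

Fact base_change_autP (g : aut k) :
  (Defs.pcomp (base_change_map (val g).1) (base_change_map (val g).2) == pid L) &&
  (Defs.pcomp (base_change_map (val g).2) (base_change_map (val g).1) == pid L).
Proof.
rewrite -!base_change_map_comp; case/andP: (valP g) => /eqP-> /eqP->.
by rewrite base_change_map_id eqxx.
Qed.
Definition base_change (g : aut k) : aut L := exist _ (_, _) (base_change_autP g).

Lemma actE (g : aut k) q : act iota g q = pact (base_change g) q.
Proof. by []. Qed.

End BaseChange.

Section Action.
Variables (k : fieldType) (L : closedFieldType) (iota : {rmorphism k -> L}).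
Local Open Scope group_scope.

Lemma act1 q : act iota 1 q = q.
Proof. by rewrite actE /polymap_of_aut /= base_change_map_id pact_id. Qed.

Lemma actM (g h : aut k) q : act iota (g * h) q = act iota g (act iota h q).
Proof. by rewrite !actE /polymap_of_aut /= base_change_map_comp pact_comp. Qed.

Lemma actK (g : aut k) : cancel (act iota g) (act iota g^-1).
Proof. by move=> q; rewrite -actM mulVg act1. Qed.

Lemma actVK (g : aut k) : cancel (act iota g^-1) (act iota g).
Proof. by move=> q; rewrite -actM mulgV act1. Qed.

Lemma act_inj (g h : aut k) : (forall q, act iota g q = act iota h q) -> g = h.
Proof.
move=> gh; apply: aut_inj; apply: (@base_change_map_inj _ _ iota).
exact: pact_inj.
Qed.

End Action.

(** * The ideal of a binomial curve *)

(** If two monomials take the same exponent under the parametrization of a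
    binomial curve, they differ by a power of the relation between x and y; [s]
    is the exponent of that power. *)
Lemma coprime_translate (a b i i' j j' : nat) :
  (0 < b)%N -> coprime a b -> (a * i + b * j' = a * i' + b * j)%N ->
  (i <= i')%N -> exists s, (i' = i + b * s)%N /\ (j' = j + a * s)%N.
Proof.
move=> b0 ab e ii'; have [s sE] : exists s, (i' - i = s * b)%N.
  apply/dvdnP; rewrite -(Gauss_dvdr _ (_ : coprime b a)) 1?coprime_sym //.
  by apply/dvdnP; exists (j' - j)%N; rewrite mulnBr mulnBl ![(_ * b)%N]mulnC; lia.
have i'E : i' = (i + b * s)%N by rewrite mulnC -sE subnKC.
exists s; split=> //; apply/eqP; rewrite -(eqn_pmul2l b0) mulnDr.
by move: e; rewrite i'E mulnDr mulnCA; lia.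
Qed.

Section BinomialIdeal.
Variable L : closedFieldType.
Implicit Types (f h q r : {mpoly L[2]}) (m : 'X_{1..2}).
Local Notation x := (varx L).
Local Notation y := (vary L).

(** Division with remainder by a binomial: replacing its first monomial by the
    second one lowers the degree in x, because 0 < b, so the process
    terminates. *)
Lemma binomial_division (b c d : nat) (lam : L) h : (0 < b)%N ->
  exists q r, h = q * (x ^+ b * y ^+ c - lam *: y ^+ d) + r /\
    {in msupp r, forall m, (m 0%R < b)%N || (m 1%R < c)%N}.
Proof.
move=> b0; set f := (_ - _).
pose P h := exists q r, h = q * f + r /\
  {in msupp r, forall m, (m 0%R < b)%N || (m 1%R < c)%N}.
have P0 : P 0.
  by exists 0, 0; split; [rewrite mul0r addr0 | move=> m; rewrite msupp0].
have PD g h' : P g -> P h' -> P (g + h').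
  case=> [q [r [-> rP]]] [q' [r' [-> rP']]]; exists (q + q'), (r + r').
  split; first by rewrite mulrDl addrACA.
  move=> m /msuppD_le; rewrite mem_cat => /orP[]; [exact: rP | exact: rP'].
have PZ g e : P g -> P (e *: g).
  case=> [q [r [-> rP]]]; exists (e *: q), (e *: r).
  by split; [rewrite scalerDr scalerAl | move=> m /msuppZ_le /rP].
have PX i j : P (x ^+ i * y ^+ j).
  elim/ltn_ind: i j => i IH j.
  have [lt|] := boolP ((i < b)%N || (j < c)%N).
    exists 0, (x ^+ i * y ^+ j); rewrite mul0r add0r; split => //.
    have -> : x ^+ i * y ^+ j = 'X_[U_(0) *+ i + U_(1) *+ j].
      by rewrite mpolyXD -!mpolyXn.
    move=> m; rewrite msuppX inE => /eqP->.
    by rewrite !mnmDE !mulmnE !mnm1E /= !mul1n !mul0n addn0.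
  rewrite negb_or -!leqNgt => /andP[bi cj].
  have -> : x ^+ i * y ^+ j = (x ^+ (i - b) * y ^+ (j - c)) * f +
     lam *: (x ^+ (i - b) * y ^+ (j - c + d)).
    rewrite /f mulrBr mulrACA -!exprD (subnK bi) (subnK cj).
    rewrite -scalerAr -mulrA -exprD.
    by rewrite subrK.
  apply: PD; last by apply/PZ/IH; rewrite ltn_subrL b0 (leq_trans b0 bi).
  exists (x ^+ (i - b) * y ^+ (j - c)), 0.
  by split; [rewrite addr0 | move=> m; rewrite msupp0].
rewrite -/(P h) [h]mpolyE; elim: (msupp h : seq _) => [|m s IH].
  by rewrite big_nil.
by rewrite big_cons; apply: PD => //; apply: PZ; rewrite mpolyX_xy.
Qed.

Lemma exists_root (b : nat) (lam : L) : (0 < b)%N -> exists rho, rho ^+ b = lam.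
Proof.
move=> b0; have /closed_rootP[z] : size ('X^b - lam%:P) != 1%N.
  by rewrite size_XnsubC // eqSS -lt0n.
by rewrite rootE !hornerE subr_eq0 => /eqP e; exists z.
Qed.

(** The curve is parametrized by t |-> (rho t^a, t^b) with rho^b = lam, and the
    monomials x^i y^j with i < b, which are the ones left by the division, take
    different exponents. *)
Lemma cusp_ideal (a b : nat) (lam : L) h :
  (0 < a)%N -> (0 < b)%N -> coprime a b -> lam != 0 ->
  zeros (x ^+ b - lam *: y ^+ a) `<=` zeros h ->
  exists q, h = q * (x ^+ b - lam *: y ^+ a).
Proof.
move=> a0 b0 ab lam0 hC; have [rho rhoE] := exists_root lam b0.
have rho0 : rho != 0.
  by apply: contraNneq lam0 => rho0; rewrite -rhoE rho0 expr0n gtn_eqF.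
have [q [r [hE rP]]] := binomial_division 0 a lam h b0.
exists q; rewrite hE expr0 mulr1; suff -> : r = 0 by rewrite addr0.
apply: (@monomial_substitution_eq0 _ r (fun m => rho ^+ m 0)
          (fun m => a * m 0%R + b * m 1%R)%N).
- by move=> m; rewrite expf_neq0.
- move=> m m' /rP; rewrite orbF => lt /rP; rewrite orbF => lt' /= e.
  suff e0 : m 0 = m' 0.
    by apply: (mnm2P e0); move/eqP: e; rewrite e0 eqn_add2l eqn_pmul2l // => /eqP.
  case/orP: (leq_total (m 0) (m' 0)) => le.
    by have [[|s] [e1 _]] := coprime_translate b0 ab e le; rewrite ?mulnS in e1; lia.
  by have [[|s] [e1 _]] := coprime_translate b0 ab (esym e) le;
    rewrite ?mulnS in e1; lia.
move=> t t0; pose p := (rho * t ^+ a, t ^+ b).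
have fp : peval (x ^+ b - lam *: y ^+ a) p = 0.
  by rewrite !pevalE /= exprMn rhoE -!exprM mulnC subrr.
have := hC p fp; rewrite /zeros /= hE expr0 mulr1 pevalD pevalM fp mulr0.
rewrite add0r peval_sum => e; rewrite -[RHS]e; apply: eq_bigr => m _ /=.
by rewrite exprMn -!exprM exprD mulrA.
Qed.

(** The curve is parametrized by t |-> (rho t^a, t^-b) with rho^b = lam, and
    the monomials not divisible by x^b y^a take different exponents. *)
Lemma hyperbola_ideal (a b : nat) (lam : L) h :
  (0 < a)%N -> (0 < b)%N -> coprime a b -> lam != 0 ->
  zeros (x ^+ b * y ^+ a - lam%:MP) `<=` zeros h ->
  exists q, h = q * (x ^+ b * y ^+ a - lam%:MP).
Proof.
move=> a0 b0 ab lam0 hC; have [rho rhoE] := exists_root lam b0.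
have rho0 : rho != 0.
  by apply: contraNneq lam0 => rho0; rewrite -rhoE rho0 expr0n gtn_eqF.
have [q [r [hE rP]]] := binomial_division a 0 lam h b0.
exists q; move: hE; rewrite expr0 alg_mpolyC => hE; rewrite hE.
suff -> : r = 0 by rewrite addr0.
pose N := msize r.
(* On the curve y = t ^ (- b); the factor t ^ (b * N) clears denominators. *)
apply: (@monomial_substitution_eq0 _ r (fun m => rho ^+ m 0)
          (fun m => a * m 0%R + b * (N - m 1%R))%N).
- by move=> m; rewrite expf_neq0.
- move=> m m' rm rm' /= e.
  have leN m1 : m1 \in msupp r -> (m1 1%R <= N)%N.
    move/msize_mdeg_lt/ltnW; apply: leq_trans; rewrite mdegE big_ord2.
    by rewrite leq_addl.
  have lb m1 : m1 \in msupp r -> (b * m1 1%R <= b * N)%N.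
    by move=> /leN; apply: leq_mul.
  have := lb m rm; have := lb m' rm'; rewrite !mulnBr in e.
  move=> l l'; have := rP m rm; have := rP m' rm'.
  case/orP: (leq_total (m 0) (m' 0)) => le u u'.
    have e' : (a * m 0%R + b * m' 1%R = a * m' 0%R + b * m 1%R)%N by lia.
    have [[|s] [e0 e1]] := coprime_translate b0 ab e' le.
      by apply: mnm2P; lia.
    by rewrite !mulnS in e0 e1; lia.
  have e' : (a * m' 0%R + b * m 1%R = a * m 0%R + b * m' 1%R)%N by lia.
  have [[|s] [e0 e1]] := coprime_translate b0 ab e' le.
    by apply: mnm2P; lia.
  by rewrite !mulnS in e0 e1; lia.
move=> t t0; pose p := (rho * t ^+ a, t ^- b).
have fp : peval (x ^+ b * y ^+ a - lam%:MP) p = 0.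
  rewrite !pevalE /= exprMn rhoE exprVn -!exprM mulnC mulfK ?subrr //.
  by rewrite expf_neq0.
have := hC p fp; rewrite /zeros /= hE pevalD pevalM fp mulr0.
rewrite add0r peval_sum => /(congr1 (fun z => t ^+ (b * N) * z)).
rewrite mulr0 mulr_sumr => e; rewrite -[RHS]e; apply: eq_big_seq => m rm /=.
have le : (m 1%R <= N)%N.
  move/msize_mdeg_lt/ltnW: rm; apply: leq_trans; rewrite mdegE big_ord2.
  by rewrite leq_addl.
have -> : (b * N = b * (N - m 1%R) + b * m 1%R)%N by rewrite -mulnDr subnK.
rewrite exprMn exprVn -!exprM !exprD; have := expf_neq0 (b * m 1%R) t0.
move/mulfV; move: (t ^+ (b * m 1%R)) => T; move: T^-1 => U TU.
by rewrite [r@_m * (_ * U)]mulrA [RHS]mulrACA TU mulr1 [RHS]mulrC !mulrA.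
Qed.

End BinomialIdeal.

(** * Automorphisms that preserve a curve *)

Section SemiInvariants.
Variable L : closedFieldType.
Implicit Types (f h u r : {mpoly L[2]}) (q : L * L) (F : aut L).
Local Notation x := (varx L).
Local Notation y := (vary L).

(** The action of automorphisms over L; the name gives the argument the type of
    automorphisms, so that products and inverses can be written in it. *)
Definition lact F q := pact F q.

Definition pullback F h := h \mPo [tuple (F : polymap L).1; (F : polymap L).2].

Lemma peval_pullback F h q : peval (pullback F h) q = peval h (lact F q).
Proof. exact: peval_comp. Qed.

Lemma lact1 q : lact 1%g q = q.
Proof. by rewrite [lact _ _]pact_id. Qed.

Lemma lactM (F G : aut L) q : lact (F * G)%g q = lact F (lact G q).
Proof. exact: pact_comp. Qed.

Lemma lactK F : cancel (lact F) (lact F^-1%g).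
Proof. by move=> q; rewrite -lactM mulVg lact1. Qed.

Lemma lactVK F : cancel (lact F^-1%g) (lact F).
Proof. by move=> q; rewrite -lactM mulgV lact1. Qed.

Lemma aut_lact_inj (F G : aut L) : (forall q, lact F q = lact G q) -> F = G.
Proof. by move=> FG; apply: aut_inj; apply: pact_inj. Qed.

HB.instance Definition _ F := GRing.RMorphism.copy (pullback F)
  (comp_mpoly [tuple (F : polymap L).1; (F : polymap L).2]).

Lemma mpoly_unitP h h' : h * h' = 1 -> exists2 c, c != 0 & h = c%:MP.
Proof.
move=> hh'; have /mpoly_intro_unit/andP[/eqP hE U] : h' * h = 1 by rewrite mulrC.
by exists h@_0%MM => //; rewrite -unitfE.
Qed.

(** The cofactors of [f] in its pullbacks by [F] and by the inverse of [F] are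
    inverse to each other up to applying [F], so they are units, that is,
    constants. *)
Lemma pullback_semi_invariant f F : f != 0 ->
  (forall h, zeros f `<=` zeros h -> exists u, h = u * f) ->
  (forall q, peval f q = 0 -> peval f (lact F q) = 0) ->
  (forall q, peval f q = 0 -> peval f (lact F^-1%g q) = 0) ->
  exists2 gam, gam != 0 & pullback F f = gam *: f.
Proof.
move=> f0 fI fF fF'.
have [q qE] : exists u, pullback F f = u * f.
  by apply: fI => p fp; rewrite /zeros /= peval_pullback; apply: fF.
have [q' q'E] : exists u, pullback F^-1%g f = u * f.
  by apply: fI => p fp; rewrite /zeros /= peval_pullback; apply: fF'.
have : q * pullback F q' = 1.
  apply: (mulIf f0); rewrite mul1r mulrAC mulrC -qE -rmorphM -q'E.
  by apply: peval_inj => p; rewrite !peval_pullback lactK.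
by case/mpoly_unitP => c c0 qc; exists c; rewrite // qE qc mul_mpolyC.
Qed.

Definition xaxis h : {poly L} :=
  mmap polyC (fun i : 'I_2 => if i == 0 then 'X else 0) h.
Definition yaxis h : {poly L} :=
  mmap polyC (fun i : 'I_2 => if i == 0 then 0 else 'X) h.
HB.instance Definition _ := GRing.RMorphism.copy xaxis
  (mmap polyC (fun i : 'I_2 => if i == 0 then 'X else 0)).
HB.instance Definition _ := GRing.RMorphism.copy yaxis
  (mmap polyC (fun i : 'I_2 => if i == 0 then 0 else 'X)).

Lemma horner_xaxis h t : (xaxis h).[t] = peval h (t, 0).
Proof.
rewrite /xaxis /mmap peval_sum horner_sum; apply: eq_bigr => m _.
by rewrite hornerM hornerC /mmap1 big_ord2 /= !hornerE.
Qed.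

Lemma horner_yaxis h t : (yaxis h).[t] = peval h (0, t).
Proof.
rewrite /yaxis /mmap peval_sum horner_sum; apply: eq_bigr => m _.
by rewrite hornerM hornerC /mmap1 big_ord2 /= !hornerE.
Qed.

(** Division by x leaves a polynomial in y, which is determined by its values
    on the axis x = 0. *)
Lemma x_dvd h : yaxis h = 0 -> exists u, h = u * x.
Proof.
move=> h0; have [q [r]] := binomial_division 0 0 0 h (isT : (0 < 1)%N).
rewrite scale0r subr0 expr1 expr0 mulr1 => -[hE rP].
exists q; rewrite hE; suff -> : r = 0 by rewrite addr0.
have m0 m : m \in msupp r -> m 0 = 0%N by move/rP; case: (m 0).
apply: (@monomial_substitution_eq0 _ r (fun=> 1) (fun m => m 1)).
- by move=> m; apply: oner_neq0.
- by move=> m m' rm rm' /=; apply: mnm2P; rewrite !m0.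
move=> t _; have := horner_yaxis h t; rewrite h0 horner0 hE pevalD pevalM.
rewrite pevalx mulr0 add0r peval_sum => e; rewrite [RHS]e.
by apply: eq_big_seq => m /m0 -> /=.
Qed.

Fact swap_autP : (Defs.pcomp (y, x) (y, x) == pid L) &&
                 (Defs.pcomp (y, x) (y, x) == pid L).
Proof.
rewrite andbb; apply/eqP/pact_inj => q.
by rewrite pact_comp pact_id /pact /= !pevalE -surjective_pairing.
Qed.
Definition swap_aut : aut L := exist _ ((y, x), (y, x)) swap_autP.

Lemma lact_swap q : lact swap_aut q = (q.2, q.1).
Proof. by rewrite /lact /pact !pevalE. Qed.

(** Follows from [x_dvd] by exchanging the variables. *)
Lemma y_dvd h : xaxis h = 0 -> exists u, h = u * y.
Proof.
move=> h0; have [|q qE] := @x_dvd (pullback swap_aut h).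
  apply/eqP; apply: contraT => /closed_nonrootP[t].
  rewrite rootE horner_yaxis peval_pullback lact_swap -horner_xaxis h0.
  by rewrite horner0 eqxx.
exists (pullback swap_aut q); apply: peval_inj => p.
rewrite !(pevalM, peval_pullback) pevaly; set p' := lact _ p.
have -> : p.2 = peval x p' by rewrite pevalx /p' lact_swap.
rewrite -pevalM -qE peval_pullback /p' !lact_swap.
by rewrite -surjective_pairing.
Qed.

Lemma size_expM_const (P Q : {poly L}) a b del : (0 < a)%N -> (0 < b)%N ->
  del != 0 -> P ^+ b * Q ^+ a = del%:P -> size P = 1%N /\ size Q = 1%N.
Proof.
move=> a0 b0 del0 e.
have : P ^+ b * Q ^+ a \is a GRing.unit.
  by rewrite e poly_unitE size_polyC del0 coefC eqxx unitfE.
rewrite unitrM !unitrX_pos // !poly_unitE.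
by case/andP => /andP[/eqP-> _] /andP[/eqP-> _].
Qed.

Lemma size1_horner (P : {poly L}) s t : size P = 1%N -> P.[s] = P.[t].
Proof.
by move=> sP; have /size1_polyC -> : (size P <= 1)%N; rewrite ?sP ?hornerC.
Qed.

End SemiInvariants.

(** * Stabilizers of hyperbolas *)

Section Hyperbolas.
Variable L : closedFieldType.
Implicit Types (f h u r : {mpoly L[2]}) (q : L * L) (F : aut L).
Local Notation x := (varx L).
Local Notation y := (vary L).

Lemma pullbackE F : (pullback F x = (F : polymap L).1) *
  (pullback F y = (F : polymap L).2) * (forall c, pullback F c%:MP = c%:MP).
Proof. by do 2?split; rewrite /pullback ?comp_mpolyXU // => c; rewrite comp_mpolyC. Qed.

Lemma xaxisE : (xaxis x = 'X) * (xaxis y = 0) *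
  (forall c : L, xaxis c%:MP = c%:P).
Proof. by do 2?split; rewrite /xaxis ?mmapX ?mmap1U // => c; rewrite mmapC. Qed.

Lemma yaxisE : (yaxis x = 0) * (yaxis y = 'X) *
  (forall c : L, yaxis c%:MP = c%:P).
Proof. by do 2?split; rewrite /yaxis ?mmapX ?mmap1U // => c; rewrite mmapC. Qed.

Lemma xaxis_not_collapsed F :
  ~ (size (xaxis (F : polymap L).1) = 1%N /\ size (xaxis (F : polymap L).2) = 1%N).
Proof.
case=> s1 s2; have : lact F (0, 0) = lact F (1, 0).
  rewrite /lact /pact -!horner_xaxis.
  by rewrite (size1_horner 0 1 s1) (size1_horner 0 1 s2).
by move/(can_inj (lactK F)) => [/eqP]; rewrite eq_sym oner_eq0.
Qed.

(** The map [F] sends the union of the two axes onto itself, and on each axis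
    one of its components vanishes. It cannot be the same component on both,
    since then the union would be mapped into one axis. So one component is
    divisible by x and the other by y, and comparison with x^b y^a shows that
    the cofactors are units, and that a = b if the axes are exchanged. *)
Lemma monomial_automorphism (a b : nat) F : (0 < a)%N -> (0 < b)%N ->
  (F : polymap L).1 ^+ b * (F : polymap L).2 ^+ a = x ^+ b * y ^+ a ->
  exists al be, [/\ al != 0, be != 0 &
    (forall q, lact F q = (al * q.1, be * q.2)) \/
    a = b /\ forall q, lact F q = (al * q.2, be * q.1)].
Proof.
set F1 := _.1; set F2 := _.2 => a0 b0 FE.
have FqE q : (lact F q).1 ^+ b * (lact F q).2 ^+ a = q.1 ^+ b * q.2 ^+ a.
  by have := congr1 (fun h => peval h q) FE; rewrite !pevalE.
have x0 : x != 0 by rewrite -msize_poly_eq0 msizeX.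
have y0 : y != 0 by rewrite -msize_poly_eq0 msizeX.
have axes : (xaxis F1 = 0 \/ xaxis F2 = 0) /\ (yaxis F1 = 0 \/ yaxis F2 = 0).
  have ex : xaxis F1 ^+ b * xaxis F2 ^+ a = 0.
    have := congr1 (@xaxis L) FE; rewrite !rmorphM !rmorphXn /= !xaxisE => ->.
    by rewrite [0 ^+ a]expr0n gtn_eqF // mulr0.
  have ey : yaxis F1 ^+ b * yaxis F2 ^+ a = 0.
    have := congr1 (@yaxis L) FE; rewrite !rmorphM !rmorphXn /= !yaxisE => ->.
    by rewrite [0 ^+ b]expr0n gtn_eqF // mul0r.
  move/eqP: ex; move/eqP: ey; rewrite !mulf_eq0 !expf_eq0 a0 b0 /=.
  by case/orP => /eqP->; case/orP => /eqP->; split; tauto.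
have onto p : p.1 ^+ b * p.2 ^+ a = 0 ->
    exists t, lact F (t, 0) = p \/ lact F (0, t) = p.
  move=> p0; have := FqE (lact F^-1%g p); rewrite lactVK p0.
  have := lactVK F p; case: (lact F^-1%g p) => s t e /esym/eqP.
  rewrite mulf_eq0 !expf_eq0 a0 b0 /=.
  by case/orP => /eqP z; rewrite z in e; [exists t; right | exists s; left].
have xy0 m n : x ^+ m * y ^+ n != 0 by rewrite mulf_neq0 ?expf_neq0.
have constants u v : v ^+ b * u ^+ a = 1 ->
    exists al be, [/\ al != 0, be != 0, v = al%:MP & u = be%:MP].
  move=> vu; have /mpoly_unitP[al al0 vE] : v * (v ^+ b.-1 * u ^+ a) = 1.
    by rewrite mulrA -exprS prednK.
  have /mpoly_unitP[be be0 uE] : u * (u ^+ a.-1 * v ^+ b) = 1.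
    by rewrite mulrA -exprS prednK // mulrC.
  by exists al, be.
case: axes => -[X0|X0] [Y0|Y0].
- have [|t [e|e]] := onto (1, 0); first by rewrite /= [0 ^+ a]expr0n gtn_eqF ?mulr0.
    have := congr1 fst e; rewrite /= -horner_xaxis -/F1 X0 horner0 => /esym/eqP.
    by rewrite oner_eq0.
  have := congr1 fst e; rewrite /= -horner_yaxis -/F1 Y0 horner0 => /esym/eqP.
  by rewrite oner_eq0.
- have [v vE] := y_dvd X0; have [u uE] := x_dvd Y0.
  have FE' : (v ^+ b * u ^+ a) * (x ^+ a * y ^+ b) = x ^+ b * y ^+ a.
    by rewrite -FE vE uE !exprMn [x ^+ a * _]mulrC mulrACA.
  have ab : a = b.
    move: (v ^+ b * u ^+ a) FE' => V FE'; have [lt|lt|//] := ltngtP a b.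
      have e : V * y ^+ (b - a) = x ^+ (b - a).
        apply: (mulIf (xy0 a a)); rewrite -[LHS]mulrA [y ^+ _ * _]mulrCA -exprD.
        by rewrite [RHS]mulrA -exprD subnK ?(ltnW lt) // -FE'.
      have := congr1 (fun h => peval h (1, 0)) e; rewrite !pevalE /= expr1n.
      rewrite [0 ^+ (b - a)]expr0n gtn_eqF ?subn_gt0 // mulr0 => /esym/eqP.
      by rewrite oner_eq0.
    have e : V * x ^+ (a - b) = y ^+ (a - b).
      apply: (mulIf (xy0 b b)); rewrite -[LHS]mulrA [x ^+ (a - b) * _]mulrA -exprD.
      by rewrite [RHS]mulrCA -exprD subnK ?(ltnW lt).
    have := congr1 (fun h => peval h (0, 1)) e; rewrite !pevalE /= expr1n.
    rewrite [0 ^+ (a - b)]expr0n gtn_eqF ?subn_gt0 // mulr0 => /esym/eqP.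
    by rewrite oner_eq0.
  have /constants[al [be [al0 be0 vc uc]]] : v ^+ b * u ^+ a = 1.
    by apply: (mulIf (xy0 a b)); rewrite FE' mul1r ab.
  exists al, be; split=> //; right; split=> // q.
  by rewrite /lact /pact -/F1 -/F2 vE uE vc uc !pevalE.
- have [v vE] := x_dvd Y0; have [u uE] := y_dvd X0.
  have /constants[al [be [al0 be0 vc uc]]] : v ^+ b * u ^+ a = 1.
    by apply: (mulIf (xy0 b a)); rewrite mul1r -{2}FE vE uE !exprMn mulrACA.
  exists al, be; split=> //; left => q.
  by rewrite /lact /pact -/F1 -/F2 vE uE vc uc !pevalE.
- have [|t [e|e]] := onto (0, 1); first by rewrite /= [0 ^+ b]expr0n gtn_eqF ?mul0r.
    have := congr1 snd e; rewrite /= -horner_xaxis -/F2 X0 horner0 => /esym/eqP.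
    by rewrite oner_eq0.
  have := congr1 snd e; rewrite /= -horner_yaxis -/F2 Y0 horner0 => /esym/eqP.
  by rewrite oner_eq0.
Qed.

(** The pullback is F1^b F2^a - lam = gam (x^b y^a - lam). On the axis y = 0
    the product F1^b F2^a is the constant (1 - gam) lam. If it were not zero,
    both components would be constant on that axis, against injectivity. So gam
    = 1, and [monomial_automorphism] applies. *)
Lemma hyperbola_stabilizer (a b : nat) (lam : L) F :
  (0 < a)%N -> (0 < b)%N -> coprime a b -> lam != 0 ->
  (forall q, zeros (x ^+ b * y ^+ a - lam%:MP) q ->
     zeros (x ^+ b * y ^+ a - lam%:MP) (lact F q)) ->
  (forall q, zeros (x ^+ b * y ^+ a - lam%:MP) q ->
     zeros (x ^+ b * y ^+ a - lam%:MP) (lact F^-1%g q)) ->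
  exists al be, [/\ al != 0, be != 0 &
    (forall q, lact F q = (al * q.1, be * q.2)) \/
    a = b /\ forall q, lact F q = (al * q.2, be * q.1)].
Proof.
move=> a0 b0 ab lam0 fF fF'; set f := (_ - _) in fF fF'.
have f0 : f != 0.
  apply: contraNneq lam0 => f0; have := congr1 (fun h => peval h (0, 0)) f0.
  rewrite /f !pevalE /= !expr0n !gtn_eqF //= mul0r sub0r.
  by move/eqP; rewrite oppr_eq0.
have [gam gam0] := pullback_semi_invariant f0
  (fun h => @hyperbola_ideal L a b lam h a0 b0 ab lam0) fF fF'.
rewrite /f rmorphB rmorphM !rmorphXn /= !pullbackE => FE.
have del0 : (1 - gam) * lam = 0.
  apply: contraTeq isT => del0; exfalso.
  apply: (@xaxis_not_collapsed F); apply: (size_expM_const a0 b0 del0).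
  apply: (addIr (- lam%:P)).
  have := congr1 (@xaxis L) FE; rewrite -mul_mpolyC.
  rewrite !(rmorphB, rmorphM, rmorphXn) /= !xaxisE => ->.
  rewrite [0 ^+ a]expr0n gtn_eqF // mulr0n polyC1.
  by move: (gam%:P) (lam%:P) => G P; ring.
have gam1 : gam = 1.
  by move/eqP: del0; rewrite mulf_eq0 (negbTE lam0) orbF subr_eq0 => /eqP.
apply: (monomial_automorphism a0 b0); apply: (addIr (- lam%:MP)).
by rewrite FE gam1 scale1r.
Qed.
End Hyperbolas.

(** * Jacobian determinants and weighted degrees *)

Lemma det2_mul_eq1 (R : comNzRingType) (A B C D G0 G1 H0 H1 : R) :
  1 = A * G1 + B * H1 -> 0 = A * G0 + B * H0 ->
  0 = C * G1 + D * H1 -> 1 = C * G0 + D * H0 ->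
  (G0 * H1 - G1 * H0) * (C * B - D * A) = 1.
Proof.
move=> h1 h2 h3 h4.
have -> : (G0 * H1 - G1 * H0) * (C * B - D * A) =
  (C * G0 + D * H0) * (A * G1 + B * H1) - (A * G0 + B * H0) * (C * G1 + D * H1).
  by ring.
by rewrite -h1 -h2 -h4 mul0r subr0 mulr1.
Qed.

Section Jacobian.
Variable L : closedFieldType.
Implicit Types (f h u r : {mpoly L[2]}) (q : L * L) (F : aut L).
Local Notation x := (varx L).
Local Notation y := (vary L).

Lemma mderiv_exp i h n : (h ^+ n)^`M(i) = n%:R * h ^+ n.-1 * h^`M(i).
Proof.
elim: n => [|n IH]; first by rewrite expr0 mul0r mul0r (mderivC _ 1).
rewrite exprS mderivM IH -(natr1 n) /=; case: n {IH} => [|n] /=.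
  by rewrite mulr0n expr0; ring.
by rewrite exprS; move: n.+1%:R => N; ring.
Qed.

Lemma mderiv_var : (x^`M(0) = 1) * (x^`M(1) = 0) * (y^`M(0) = 0) * (y^`M(1) = 1).
Proof.
have e (i : 'I_2) : (U_(i) - U_(i))%MM = 0%MM :> 'X_{1..2}.
  by apply/mnmP => j; rewrite mnmBE subnn mnm0E.
by rewrite !mderivX !mnm1E /= !e !scale0r !mpolyX0 !scale1r.
Qed.

Lemma chain_rule F h i : (pullback F h)^`M(i) =
  pullback F h^`M(0) * (F : polymap L).1^`M(i) +
  pullback F h^`M(1) * (F : polymap L).2^`M(i).
Proof.
elim/mpoly_alg_ind: h => [c|||f g IHf IHg|f g IHf IHg].
- by rewrite pullbackE !mderivC rmorph0 !mul0r addr0.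
- by rewrite pullbackE !mderiv_var rmorph0 rmorph1 mul0r mul1r addr0.
- by rewrite pullbackE !mderiv_var rmorph0 rmorph1 mul0r mul1r add0r.
- by rewrite !(rmorphD, mderivD) /= IHf IHg; ring.
by rewrite !(rmorphM, rmorphD, mderivM) /= IHf IHg; ring.
Qed.

Definition jacobian F : {mpoly L[2]} :=
  (F : polymap L).1^`M(0) * (F : polymap L).2^`M(1) -
  (F : polymap L).1^`M(1) * (F : polymap L).2^`M(0).

(** By the chain rule the Jacobian determinant of the inverse, pulled back by
    [F], is an inverse of that of [F]. *)
Lemma jacobian_const F : exists2 c, c != 0 & jacobian F = c%:MP.
Proof.
have e1 : pullback F (polymap_of_aut F^-1%g).1 = x.
  apply: peval_inj => q; rewrite peval_pullback pevalx.
  exact: (congr1 fst (lactK F q)).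
have e2 : pullback F (polymap_of_aut F^-1%g).2 = y.
  apply: peval_inj => q; rewrite peval_pullback pevaly.
  exact: (congr1 snd (lactK F q)).
have := chain_rule F (polymap_of_aut F^-1%g).1 0.
have := chain_rule F (polymap_of_aut F^-1%g).1 1.
have := chain_rule F (polymap_of_aut F^-1%g).2 0.
have := chain_rule F (polymap_of_aut F^-1%g).2 1.
rewrite e1 e2 !mderiv_var /jacobian.
set A := pullback F _; set B := pullback F _; set C := pullback F _.
set D := pullback F _ => h1 h2 h3 h4.
apply: (@mpoly_unitP _ _ (C * B - D * A)).
exact: det2_mul_eq1 h1 h2 h3 h4.
Qed.

End Jacobian.

Section WeightedDegree.
Variables (L : closedFieldType) (a b : nat).
Implicit Types (f h u r : {mpoly L[2]}) (m : 'X_{1..2}).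
Local Notation x := (varx L).
Local Notation y := (vary L).

(** The homomorphism x |-> x t^a, y |-> y t^b; its degree in t is the weighted
    degree, which is therefore additive on products. *)
Definition wpoly h : {poly {mpoly L[2]}} :=
  mmap (polyC \o @mpolyC 2 L)
    (fun i : 'I_2 => if i == 0 then x%:P * 'X^a else y%:P * 'X^b) h.
HB.instance Definition _ := GRing.RMorphism.copy wpoly
  (mmap (polyC \o @mpolyC 2 L)
    (fun i : 'I_2 => if i == 0 then x%:P * 'X^a else y%:P * 'X^b)).

(** The weighted degree plus one, or 0 for the zero polynomial. *)
Definition wsize h := size (wpoly h).

Lemma coef_wpoly h m n :
  ((wpoly h)`_n)@_m = if n == (a * m 0%R + b * m 1%R)%N then h@_m else 0.
Proof.
rewrite /wpoly /mmap coef_sum raddf_sum /=.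
have e m' : (((h@_m')%:MP_[2])%:P *
    mmap1 (fun i : 'I_2 => if i == 0 then x%:P * 'X^a else y%:P * 'X^b) m')`_n
    = if n == (a * m' 0%R + b * m' 1%R)%N then h@_m' *: 'X_[m'] else 0.
  rewrite /mmap1 big_ord2 /= !exprMn mulrACA -!exprM -exprD -!rmorphXn -rmorphM.
  rewrite -mpolyX_xy mulrA -rmorphM coefCM coefXn mul_mpolyC /=.
  by case: eqP => _; rewrite ?mulr1 ?mulr0.
under eq_bigr do rewrite e.
have [hm|hm] := boolP (m \in msupp h); last first.
  rewrite big1_seq ?(memN_msupp_eq0 hm) ?if_same // => m' /= hm'.
  case: ifP => _; rewrite ?mcoeff0 // mcoeffZ mcoeffX.
  by case: eqP => [mm|_]; [rewrite -mm hm' in hm | rewrite mulr0].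
rewrite (bigD1_seq m) ?msupp_uniq //= big1_seq ?addr0.
  by case: ifP => _; rewrite ?mcoeff0 // mcoeffZ mcoeffX eqxx mulr1.
move=> m' /andP[/negbTE mm _]; case: ifP => _; rewrite ?mcoeff0 //.
by rewrite mcoeffZ mcoeffX mm mulr0.
Qed.

Lemma wsize_leP h N : reflect
  (forall m, h@_m != 0 -> (a * m 0%R + b * m 1%R < N)%N) (wsize h <= N)%N.
Proof.
apply: (iffP (leq_sizeP (wpoly h) N)) => [hN m|hN j Nj].
  apply: contraNT; rewrite -leqNgt => /hN/(congr1 (mcoeff m)).
  by rewrite coef_wpoly eqxx mcoeff0 => ->.
apply/mpolyP => m; rewrite coef_wpoly mcoeff0; case: eqP => // jE.
by apply/eqP; apply: contraTT Nj => /hN; rewrite -jE -ltnNge.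
Qed.

Lemma wsize_eq0 h : (wsize h == 0)%N = (h == 0).
Proof.
apply/eqP/eqP => [h0|->]; last by rewrite /wsize rmorph0 size_poly0.
apply/mpolyP => m; rewrite mcoeff0; apply/eqP; apply: contraT => hm.
by have /wsize_leP/(_ m hm) : (wsize h <= 0)%N by rewrite h0.
Qed.

Lemma wpoly_eq0 h : (wpoly h == 0) = (h == 0).
Proof. by rewrite -size_poly_eq0 wsize_eq0. Qed.

Lemma wsizeM f h : f != 0 -> h != 0 -> wsize (f * h) = (wsize f + wsize h).-1.
Proof.
by move=> f0 h0; rewrite /wsize rmorphM size_mul // wpoly_eq0.
Qed.

Lemma wsizeX h n : h != 0 -> wsize (h ^+ n) = ((wsize h).-1 * n).+1.
Proof.
move=> h0; rewrite /wsize rmorphXn -size_exp prednK // lt0n size_poly_eq0.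
by rewrite expf_eq0 wpoly_eq0 (negbTE h0) andbF.
Qed.

Lemma wsizeD f h N : (wsize f <= N)%N -> (wsize h <= N)%N -> (wsize (f + h) <= N)%N.
Proof.
move=> /wsize_leP fN /wsize_leP hN; apply/wsize_leP => m; rewrite mcoeffD.
have [f0|f0 _] := eqVneq f@_m 0; last by apply: fN.
by rewrite f0 add0r; apply: hN.
Qed.

Lemma wsizeCM c h N : (wsize h <= N)%N -> (wsize (c%:MP * h) <= N)%N.
Proof.
move=> /wsize_leP hN; apply/wsize_leP => m; rewrite mcoeffCM mulf_eq0 negb_or.
by case/andP => _ /hN.
Qed.

Lemma wsize_monom i j : wsize (x ^+ i * y ^+ j) = (a * i + b * j).+1.
Proof.
pose m : 'X_{1..2} := (U_(0%R) *+ i + U_(1%R) *+ j)%MM.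
have mE : m 0 = i /\ m 1 = j.
  by rewrite !mnmDE !mulmnE !mnm1E /= !mul1n !mul0n addn0.
case: mE => m0 m1; have -> : x ^+ i * y ^+ j = 'X_[m] by rewrite mpolyX_xy m0 m1.
apply/eqP; rewrite eqn_leq; apply/andP; split.
  apply/wsize_leP => m'; rewrite mcoeffX; have [<- _|_] := eqVneq m m'.
    by rewrite m0 m1.
  by rewrite eqxx.
have /wsize_leP/(_ m) := leqnn (wsize 'X_[m]).
by rewrite mcoeffX eqxx oner_neq0 m0 m1; apply.
Qed.

Lemma wsize_xn n : wsize (x ^+ n) = (a * n).+1.
Proof. by have := wsize_monom n 0; rewrite expr0 mulr1 muln0 addn0. Qed.

Lemma wsize_yn n : wsize (y ^+ n) = (b * n).+1.
Proof. by have := wsize_monom 0 n; rewrite expr0 mul1r muln0 add0n. Qed.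

Lemma wsize_mderiv_x h : h^`M(0) != 0 -> (wsize h^`M(0%R) + a <= wsize h)%N.
Proof.
move=> h0; have lt0 : (0 < wsize h^`M(0%R))%N by rewrite lt0n wsize_eq0.
suff : (wsize h^`M(0%R) <= wsize h - a)%N by lia.
apply/wsize_leP => m; rewrite mcoeff_deriv => hm.
have /wsize_leP/(_ (m + U_(0%R))%MM) := leqnn (wsize h).
rewrite !mnmDE !mnm1E /= => lt; suff /lt : h@_(m + U_(0)) != 0 by lia.
by apply: contraNneq hm => ->; rewrite mul0rn.
Qed.

Lemma wsize_mderiv_y h : h^`M(1) != 0 -> (wsize h^`M(1%R) + b <= wsize h)%N.
Proof.
move=> h1; have lt0 : (0 < wsize h^`M(1%R))%N by rewrite lt0n wsize_eq0.
suff : (wsize h^`M(1%R) <= wsize h - b)%N by lia.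
apply/wsize_leP => m; rewrite mcoeff_deriv => hm.
have /wsize_leP/(_ (m + U_(1%R))%MM) := leqnn (wsize h).
rewrite !mnmDE !mnm1E /= => lt; suff /lt : h@_(m + U_(1)) != 0 by lia.
by apply: contraNneq hm => ->; rewrite mul0rn.
Qed.

End WeightedDegree.

(** * Stabilizers of cusps *)

Lemma leq_add_mul (a b : nat) : (1 < a)%N -> (1 < b)%N -> (a + b <= a * b)%N.
Proof.
move=> a1 b1; have [lt|lt] := leqP a b.
  by have : (2 * b <= a * b)%N; [rewrite leq_mul2r a1 orbT | lia].
by have : (a * 2 <= a * b)%N; [rewrite leq_mul2l b1 orbT | lia].
Qed.

(** If b d1 exceeds a b, the two maxima force b d1 = a d2, and the last
    hypothesis, multiplied by a or by b, becomes d1 (ab - a - b) <= a (ab - a -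
    b) or d2 (ab - a - b) <= b (ab - a - b). As ab - a - b is positive, this
    contradicts the assumption. *)
Lemma cusp_degree_bound (a b d1 d2 : nat) : (1 < a)%N -> (1 < b)%N ->
  coprime a b -> (b * d1 <= maxn (a * b) (a * d2))%N ->
  (a * d2 <= maxn (a * b) (b * d1))%N ->
  (b.-1 * d1 + (a + b) <= a * b + d2)%N \/
  (a.-1 * d2 + (a + b) <= a * b + d1)%N ->
  (d1 <= a)%N /\ (d2 <= b)%N.
Proof.
move=> a1 b1 ab; have neq : a != b.
  by apply: contraTneq ab => ->; rewrite /coprime gcdnn gtn_eqF.
have K : exists k, (a * b = a + b + k.+1)%N.
  exists ((a * b) - (a + b) - 1)%N.
  have : (a + b < a * b)%N.
    have [lt|lt|e] := ltngtP a b; last by rewrite e eqxx in neq.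
      by have : (2 * b <= a * b)%N; [rewrite leq_mul2r a1 orbT | lia].
    by have : (a * 2 <= a * b)%N; [rewrite leq_mul2l b1 orbT | lia].
  by lia.
case: K => k kE h1 h2 h3.
have aP : (0 < a)%N by lia.
have bP : (0 < b)%N by lia.
have [le|gt] := leqP (b * d1) (a * b).
  move: h2; rewrite (maxn_idPl le) leq_pmul2l // => ->; split=> //.
  by move: le; rewrite [(a * b)%N]mulnC leq_pmul2l.
have e : (a * d2 = b * d1)%N by lia.
have -> : b = b.-1.+1 by lia.
exfalso; case: h3 => h3.
  have : (a * (b.-1 * d1 + (a + b)) <= a * (a * b + d2))%N by rewrite leq_pmul2l.
  have lt : (a < d1)%N by move: gt; rewrite [(a * b)%N]mulnC ltn_pmul2l.
  have : (a * k.+1 < d1 * k.+1)%N by rewrite ltn_pmul2r.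
  have bE : b = b.-1.+1 by lia.
  have : (a * b * d1 = (a + b + k.+1) * d1)%N by rewrite kE.
  have : (a * (a * b) = a * (a + b + k.+1))%N by rewrite kE.
  rewrite !mulnDr !mulnDl e; have : (a * (b.-1 * d1) + a * d1 = a * b * d1)%N.
    by rewrite -mulnDr -mulSnr -bE mulnA.
  by lia.
have : (b * (a.-1 * d2 + (a + b)) <= b * (a * b + d1))%N by rewrite leq_pmul2l.
have lt : (b < d2)%N by move: gt; rewrite -e ltn_pmul2l.
have : (b * k.+1 < d2 * k.+1)%N by rewrite ltn_pmul2r.
have aE : a = a.-1.+1 by lia.
have : (a * b * d2 = (a + b + k.+1) * d2)%N by rewrite kE.
have : (b * (a * b) = b * (a + b + k.+1))%N by rewrite kE.
rewrite !mulnDr !mulnDl -e; have : (b * (a.-1 * d2) + b * d2 = a * b * d2)%N.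
  by rewrite -mulnDr -mulSnr -aE mulnA [(b * a)%N]mulnC.
by lia.
Qed.

(** Otherwise b is a multiple of a, by comparison of degrees. *)
Lemma exp_eq_scaleXn (L : fieldType) (P : {poly L}) a b c :
  (1 < a)%N -> coprime a b -> P ^+ a = c *: 'X^b -> P = 0.
Proof.
move=> a1 ab e; apply/eqP; apply: contraT => P0.
have c0 : c != 0.
  by apply: contraNneq P0 => c0; move/eqP: e; rewrite c0 scale0r expf_eq0 => /andP[].
have := size_exp P a; rewrite e size_scale // size_polyXn /= => bE.
by move: ab; rewrite bE /coprime gcdnMl gtn_eqF.
Qed.

(** Cramer's rule for the gradients of the two sides of the semi-invariance:
    the derivatives of the power of the second component are eliminated. *)
Lemma eliminate_F2 (R : comNzRingType) (A B P Q X Y c l g0 g1 h0 h1 : R) :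
  B * P * g0 - l * (A * Q * h0) = c * (B * X) ->
  B * P * g1 - l * (A * Q * h1) = c * - (l * (A * Y)) ->
  B * P * (g0 * h1 - g1 * h0) = c * (B * (X * h1) + l * A * (Y * h0)).
Proof.
move=> e0 e1; have -> : B * P * (g0 * h1 - g1 * h0) =
    (B * P * g0 - l * (A * Q * h0)) * h1 - (B * P * g1 - l * (A * Q * h1)) * h0.
  by ring.
by rewrite e0 e1; ring.
Qed.

(** The other half of Cramer's rule, in which the derivatives of the power of
    the first component are eliminated. *)
Lemma eliminate_F1 (R : comNzRingType) (A B P Q X Y c l g0 g1 h0 h1 : R) :
  B * P * g0 - l * (A * Q * h0) = c * (B * X) ->
  B * P * g1 - l * (A * Q * h1) = c * - (l * (A * Y)) ->
  l * A * Q * (g0 * h1 - g1 * h0) = c * (B * (X * g1) + l * A * (Y * g0)).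
Proof.
move=> e0 e1; have -> : l * A * Q * (g0 * h1 - g1 * h0) =
    (B * P * g0 - l * (A * Q * h0)) * g1 - (B * P * g1 - l * (A * Q * h1)) * g0.
  by ring.
by rewrite e0 e1; ring.
Qed.

Section Cusps.
Variable L : closedFieldType.
Implicit Types (f h u r : {mpoly L[2]}) (q : L * L) (F : aut L).
Local Notation x := (varx L).
Local Notation y := (vary L).

Lemma cusp_gradients (a b : nat) (lam gam : L) F :
  pullback F (x ^+ b - lam *: y ^+ a) = gam *: (x ^+ b - lam *: y ^+ a) ->
  let F1 := (F : polymap L).1 in let F2 := (F : polymap L).2 in
  b%:R * F1 ^+ b.-1 * jacobian F = gam%:MP *
    (b%:R * (x ^+ b.-1 * F2^`M(1)) + (lam * a%:R)%:MP * (y ^+ a.-1 * F2^`M(0))) /\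
  (lam * a%:R)%:MP * F2 ^+ a.-1 * jacobian F = gam%:MP *
    (b%:R * (x ^+ b.-1 * F1^`M(1)) + (lam * a%:R)%:MP * (y ^+ a.-1 * F1^`M(0))).
Proof.
rewrite -!mul_mpolyC rmorphB rmorphM !rmorphXn /= !pullbackE.
set F1 := _.1; set F2 := _.2 => e; rewrite /jacobian -/F1 -/F2.
have d i := congr1 (mderiv i) e.
have := d 0; have := d 1.
rewrite !(mderivB, mderiv_mulC, mderiv_exp, mderiv_var) !(mulr0, mulr1) subr0 sub0r.
move=> e1 e0.
rewrite mpolyCM rmorph_nat; split; first exact: eliminate_F2 e0 e1.
exact: eliminate_F1 e0 e1.
Qed.

(** Each partial derivative lowers the weighted degree of [h] by the weight of
    its variable, so both products on the right have weighted degree at most ab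
    - a - b plus that of [h]. *)
Lemma wronskian_bound (a b n : nat) (c d e s : L) (G h : {mpoly L[2]}) :
  (1 < a)%N -> (1 < b)%N -> e != 0 -> G != 0 ->
  e%:MP * G ^+ n = c%:MP *
    (s%:MP * (x ^+ b.-1 * h^`M(1)) + d%:MP * (y ^+ a.-1 * h^`M(0))) ->
  (n * (wsize a b G).-1 + 1 + (a + b) <= a * b + wsize a b h)%N.
Proof.
move=> a1 b1 e0 G0 eG; have aP : (0 < a)%N by lia.
have bP : (0 < b)%N by lia.
have le := leq_add_mul a1 b1.
have x0 : x != 0 by rewrite -msize_poly_eq0 msizeX.
have y0 : y != 0 by rewrite -msize_poly_eq0 msizeX.
have w1 : (wsize a b (x ^+ b.-1 * h^`M(1%R)) <= a * b + wsize a b h - (a + b))%N.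
  have [->|h1] := eqVneq h^`M(1) 0; first by rewrite mulr0 /wsize rmorph0 size_poly0.
  rewrite wsizeM ?expf_neq0 // wsize_xn.
  have := @wsize_mderiv_y L a b h h1.
  have -> : (a * b = a * b.-1 + a)%N by rewrite -mulnSr prednK.
  by rewrite /=; lia.
have w2 : (wsize a b (y ^+ a.-1 * h^`M(0%R)) <= a * b + wsize a b h - (a + b))%N.
  have [->|h1] := eqVneq h^`M(0) 0; first by rewrite mulr0 /wsize rmorph0 size_poly0.
  rewrite wsizeM ?expf_neq0 // wsize_yn.
  have := @wsize_mderiv_x L a b h h1.
  have -> : (a * b = b * a.-1 + b)%N by rewrite -mulnSr prednK // mulnC.
  by rewrite /=; lia.
suff : ((wsize a b G).-1 * n + 1 <= a * b + wsize a b h - (a + b))%N by lia.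
rewrite addn1 -(@wsizeX _ a b G n G0).
have -> : G ^+ n = (e^-1)%:MP * (e%:MP * G ^+ n).
  by rewrite mulrA -mpolyCM mulVf // mul1r.
by rewrite eG; do 2!apply: wsizeCM; apply: wsizeD; apply: wsizeCM.
Qed.

Lemma aut_neq0 F : (F : polymap L).1 != 0 /\ (F : polymap L).2 != 0.
Proof.
have e := lactVK F (1, 1); split; apply/eqP => F0.
  have := congr1 fst e; rewrite /lact /= F0 /peval meval0 => /esym/eqP.
  by rewrite oner_eq0.
have := congr1 snd e; rewrite /lact /= F0 /peval meval0 => /esym/eqP.
by rewrite oner_eq0.
Qed.

Lemma coprime_natr_neq0 (a b : nat) : (0 < a)%N -> coprime a b ->
  (a%:R : L) != 0 \/ (b%:R : L) != 0.
Proof.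
move=> a0 /(coprimeP _ a0)[[u v] /= uv].
have [az|] := eqVneq (a%:R : L) 0; [right | by left].
apply: contra_neq (oner_neq0 L) => bz; have e : (u * a = v * b + 1)%N by lia.
have := congr1 (fun n => n%:R : L) e.
by rewrite natrD !natrM az bz !mulr0 add0r => ->.
Qed.

(** One of a and b is nonzero in L, and [cusp_gradients] then expresses a power
    of the first or of the second component by the derivatives of the other
    one. Taking weighted degrees gives the bounds; evaluating at the origin
    shows that this component vanishes there, and the equation of the curve
    that so does the other one. *)
Lemma cusp_degrees (a b : nat) (lam gam : L) F :
  (1 < a)%N -> (1 < b)%N -> coprime a b -> lam != 0 -> gam != 0 ->
  pullback F (x ^+ b - lam *: y ^+ a) = gam *: (x ^+ b - lam *: y ^+ a) ->
  [/\ ((wsize a b (F : polymap L).1).-1 <= a)%N,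
      ((wsize a b (F : polymap L).2).-1 <= b)%N & lact F (0, 0) = (0, 0)].
Proof.
move=> a1 b1 ab lam0 gam0 FE; have /= [g1 g2] := cusp_gradients FE.
have [c c0 JE] := jacobian_const F; have [F10 F20] := aut_neq0 F.
move: FE g1 g2 F10 F20; rewrite -!mul_mpolyC rmorphB rmorphM !rmorphXn /=.
rewrite !pullbackE JE; set F1 := _.1; set F2 := _.2 => FE g1 g2 F10 F20.
pose w := @wsize L a b.
have wF1 : w F1 = (w F1).-1.+1 by rewrite prednK // lt0n wsize_eq0.
have wF2 : w F2 = (w F2).-1.+1 by rewrite prednK // lt0n wsize_eq0.
pose R := gam%:MP * (x ^+ b - lam%:MP * y ^+ a).
have wR : (w R <= (a * b).+1)%N.
  apply: wsizeCM; rewrite -mulNr -mpolyCN; apply: wsizeD; first by rewrite wsize_xn.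
  by apply: wsizeCM; rewrite wsize_yn mulnC.
have h1 : (b * (w F1).-1 <= maxn (a * b) (a * (w F2).-1))%N.
  rewrite -ltnS mulnC -(@wsizeX _ a b F1 b F10).
  have -> : F1 ^+ b = R + lam%:MP * F2 ^+ a by rewrite /R -FE subrK.
  apply: wsizeD; first by apply: leq_trans wR _; rewrite ltnS leq_maxl.
  apply: wsizeCM; rewrite (@wsizeX _ a b F2 a F20) ltnS [X in (X <= _)%N]mulnC.
  exact: leq_maxr.
have h2 : (a * (w F2).-1 <= maxn (a * b) (b * (w F1).-1))%N.
  rewrite -ltnS mulnC -(@wsizeX _ a b F2 a F20).
  have -> : F2 ^+ a = (lam^-1)%:MP * (F1 ^+ b + (-1)%:MP * R).
    rewrite /R -FE mpolyCN mulN1r opprB addrCA subrr addr0 mulrA -mpolyCM mulVf //.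
    by rewrite mul1r.
  apply: wsizeCM; apply: wsizeD; last first.
    by apply: wsizeCM; apply: leq_trans wR _; rewrite ltnS leq_maxl.
  rewrite (@wsizeX _ a b F1 b F10) ltnS [X in (X <= _)%N]mulnC.
  exact: leq_maxr.
have z1 : peval F1 (0, 0) = 0 <-> peval F2 (0, 0) = 0.
  have := congr1 (fun h => peval h (0, 0)) FE; rewrite !pevalE /= !expr0n.
  rewrite !gtn_eqF ?(ltnW a1) ?(ltnW b1) //= !mulr0 subrr mulr0 => e.
  split=> e0; move/eqP: e; rewrite e0 expr0n gtn_eqF ?(ltnW a1) ?(ltnW b1) //=.
    by rewrite sub0r oppr_eq0 mulf_eq0 (negbTE lam0) /= expf_eq0 => /andP[_ /eqP].
  by rewrite mulr0 subr0 expf_eq0 => /andP[_ /eqP].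
have z0 : peval F1 (0, 0) = 0 /\ peval F2 (0, 0) = 0 ->
    lact F (0, 0) = (0, 0) by case=> e1 e2; rewrite /lact /pact e1 e2.
have b0 : (0 < b)%N by lia.
have a0 : (0 < a)%N by lia.
have x00 n : (1 < n)%N -> (0 : L) ^+ n.-1 = 0.
  by move=> n1; rewrite expr0n gtn_eqF // -ltnS prednK // ltnW.
have bE : b%:R = (b%:R : L)%:MP :> {mpoly L[2]} by rewrite rmorph_nat.
rewrite bE in g1 g2.
have [an|bn] := coprime_natr_neq0 a0 ab.
  have e0 : lam * a%:R * c != 0 by rewrite !mulf_neq0.
  have g2' : (lam * a%:R * c)%:MP * F2 ^+ a.-1 = gam%:MP *
      ((b%:R)%:MP * (x ^+ b.-1 * F1^`M(1)) +
       (lam * a%:R)%:MP * (y ^+ a.-1 * F1^`M(0))).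
    by rewrite -g2 [(_ * c)%:MP]mpolyCM mulrAC.
  have [|d1 d2] := cusp_degree_bound a1 b1 ab h1 h2.
    right; have := wronskian_bound a1 b1 e0 F20 g2'.
    by rewrite -!/(w _) {2}wF1; lia.
  split=> //; apply: z0; rewrite z1.
  have := congr1 (fun h => peval h (0, 0)) g2'; rewrite !pevalE /= !x00 //.
  rewrite !mul0r !mulr0 addr0 mulr0 => /eqP.
  by rewrite mulf_eq0 (negbTE e0) /= expf_eq0 => /andP[_ /eqP].
have e0 : b%:R * c != 0 by rewrite !mulf_neq0.
have g1' : (b%:R * c)%:MP * F1 ^+ b.-1 = gam%:MP *
    ((b%:R)%:MP * (x ^+ b.-1 * F2^`M(1)) +
     (lam * a%:R)%:MP * (y ^+ a.-1 * F2^`M(0))).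
  by rewrite -g1 [(_ * c)%:MP]mpolyCM mulrAC.
have [|d1 d2] := cusp_degree_bound a1 b1 ab h1 h2.
  left; have := wronskian_bound a1 b1 e0 F10 g1'.
  by rewrite -!/(w _) {2}wF2; lia.
split=> //; apply: z0; rewrite -z1.
have := congr1 (fun h => peval h (0, 0)) g1'; rewrite !pevalE /= !x00 //.
rewrite !mul0r !mulr0 addr0 mulr0 => /eqP.
by rewrite mulf_eq0 (negbTE e0) /= expf_eq0 => /andP[_ /eqP].
Qed.

Lemma size_xaxis h N : (forall m, h@_m != 0 -> (m 0%R < N)%N) ->
  (size (xaxis h) <= N)%N.
Proof.
move=> hN; rewrite /xaxis /mmap.
apply: (leq_trans (size_sum _ _ _)); apply/bigmax_leqP_seq => m hm _.
have [m0 m1] : (m 0%R < N)%N /\ (0 < N)%N.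
  by have := hN m; rewrite -mcoeff_msupp => /(_ hm); lia.
rewrite mul_polyC /mmap1 big_ord2 /= mulrC.
apply: (leq_trans (size_scale_leq _ _)).
case: (m 1) => [|n]; last by rewrite expr0n mul0r size_poly0.
by rewrite expr0 mul1r size_polyXn.
Qed.

(** Both weights are positive, so 1 is the only monomial of weight 0. *)
Lemma wsize1_const a b u : (0 < a)%N -> (0 < b)%N -> (wsize a b u <= 1)%N ->
  exists c, u = c%:MP.
Proof.
move=> a0 b0 /wsize_leP u1; exists u@_0%MM; apply/mpolyP => m; rewrite mcoeffC.
have [->|m0] := eqVneq m 0%MM; first by rewrite mulr1.
rewrite mulr0; apply/eqP; apply: contraNT m0 => /u1.
rewrite ltnS leqn0 addn_eq0 !muln_eq0 (gtn_eqF a0) (gtn_eqF b0) /=.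
case/andP=> /eqP m0 /eqP m1.
by apply/eqP/mnm2P; rewrite mnm0E.
Qed.

(** As the origin is fixed, the degree bound makes the first component a
    multiple of x on the axis y = 0, so the semi-invariance makes the a-th
    power of the second component a multiple of x^b there. As a does not divide
    b, the second component vanishes on that axis, and by the degree bound it
    is a constant multiple of y. Then the same argument applies on the axis x =
    0. *)
Lemma cusp_stabilizer (a b : nat) (lam : L) F :
  (1 < a)%N -> (1 < b)%N -> coprime a b -> lam != 0 ->
  (forall q, zeros (x ^+ b - lam *: y ^+ a) q ->
     zeros (x ^+ b - lam *: y ^+ a) (lact F q)) ->
  (forall q, zeros (x ^+ b - lam *: y ^+ a) q ->
     zeros (x ^+ b - lam *: y ^+ a) (lact F^-1%g q)) ->
  exists al be, forall q, lact F q = (al * q.1, be * q.2).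
Proof.
move=> a1 b1 ab lam0 fF fF'.
have a0 : (0 < a)%N by lia.
have b0 : (0 < b)%N by lia.
set f := (_ - _) in fF fF'.
have f0 : f != 0.
  apply: contraNneq lam0 => f0; have := congr1 (fun h => peval h (0, 1)) f0.
  rewrite /f !pevalE /= !expr0n !expr1n !gtn_eqF //= mulr1 sub0r.
  by move/eqP; rewrite oppr_eq0.
have [gam gam0 FE] := pullback_semi_invariant f0
  (fun h => @cusp_ideal L a b lam h a0 b0 ab lam0) fF fF'.
have [d1 d2 z] := cusp_degrees a1 b1 ab lam0 gam0 FE.
have [F10 F20] := aut_neq0 F.
move: FE d1 d2 F10 F20; rewrite /f -!mul_mpolyC rmorphB rmorphM !rmorphXn /=.
rewrite !pullbackE; set F1 := _.1; set F2 := _.2 => FE d1 d2 F10 F20.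
have x0 : x != 0 by rewrite -msize_poly_eq0 msizeX.
have y0 : y != 0 by rewrite -msize_poly_eq0 msizeX.
have w1 : (wsize a b F1 <= a.+1)%N by lia.
have w2 : (wsize a b F2 <= b.+1)%N by lia.
have Q2 : (size (xaxis F1) <= 2)%N.
  apply: size_xaxis => m Fm; have /wsize_leP/(_ m Fm) := w1.
  rewrite ltnS => le; rewrite ltnS -(@leq_pmul2l a) //.
  by rewrite muln1; apply: leq_trans le; apply: leq_addr.
have Q0 : (xaxis F1)`_0 = 0.
  by rewrite -horner_coef0 horner_xaxis; exact: (congr1 fst z).
have QE : xaxis F1 = (xaxis F1)`_1 *: 'X.
  apply/polyP => -[|[|i]]; rewrite coefZ coefX ?mulr0 ?mulr1 //.
  by rewrite nth_default // (leq_trans Q2).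
have P0 : xaxis F2 = 0.
  set al := (xaxis F1)`_1 in QE.
  apply: (@exp_eq_scaleXn _ _ a b (lam^-1 * (al ^+ b - gam))) => //.
  have := congr1 (@xaxis L) FE.
  rewrite !(rmorphB, rmorphM, rmorphXn) /= !xaxisE QE.
  rewrite [0 ^+ a]expr0n gtn_eqF // mulr0 subr0 exprZn => e.
  apply: (scalerI lam0); rewrite scalerA mulrA mulfV // mul1r scalerBl.
  by rewrite -!mul_polyC in e *; rewrite -e opprB addrC subrK.
have [u uE] := y_dvd P0.
have [be ue] : exists be, u = be%:MP.
  apply: (@wsize1_const a b) => //; have u0 : u != 0.
    by apply: contraNneq F20 => u0; rewrite uE u0 mul0r.
  by move: w2; rewrite uE (wsizeM _ _ u0 y0) -[y]expr1 wsize_yn; lia.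
have R0 : yaxis F1 = 0.
  apply: (@exp_eq_scaleXn _ _ b a (lam * (be ^+ a - gam))) => //.
    by rewrite coprime_sym.
  have := congr1 (@yaxis L) FE.
  rewrite !(rmorphB, rmorphM, rmorphXn) /= uE ue rmorphM /= !yaxisE.
  rewrite [0 ^+ b]expr0n gtn_eqF // mulr0n sub0r exprMn => e.
  rewrite -mul_polyC polyCM polyCB rmorphXn /=.
  rewrite -[LHS](subrK (lam%:P * (be%:P ^+ a * 'X^a))).
  by rewrite e; ring.
have [v vE] := x_dvd R0.
have [al ve] : exists al, v = al%:MP.
  apply: (@wsize1_const a b) => //; have v0 : v != 0.
    by apply: contraNneq F10 => v0; rewrite vE v0 mul0r.
  by move: w1; rewrite vE (wsizeM _ _ v0 x0) -[x]expr1 wsize_xn; lia.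
exists al, be => q; rewrite /lact /pact -/F1 -/F2 uE vE ue ve.
by rewrite !pevalE.
Qed.
End Cusps.

(** * Conics over the algebraic closure *)

Section Conics.
Variables (k : fieldType) (L : closedFieldType) (iota : {rmorphism k -> L}).
Implicit Types (q : L * L).

(** Evaluation at points over L of polynomials over k, kept folded so that it
    can be expanded by [kpevalE]. *)
Definition kpeval (f : {mpoly k[2]}) q := peval (map_mpoly iota f) q.

Lemma kpevalD f g q : kpeval (f + g) q = kpeval f q + kpeval g q.
Proof. by rewrite /kpeval rmorphD /= pevalD. Qed.
Lemma kpevalB f g q : kpeval (f - g) q = kpeval f q - kpeval g q.
Proof. by rewrite /kpeval rmorphB /= pevalB. Qed.
Lemma kpevalN f q : kpeval (- f) q = - kpeval f q.
Proof. by rewrite /kpeval rmorphN /= pevalN. Qed.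
Lemma kpevalM f g q : kpeval (f * g) q = kpeval f q * kpeval g q.
Proof. by rewrite /kpeval rmorphM /= pevalM. Qed.
Lemma kpevalX f n q : kpeval (f ^+ n) q = kpeval f q ^+ n.
Proof. by rewrite /kpeval rmorphXn /= pevalXn. Qed.
Lemma kpevalZ c f q : kpeval (c *: f) q = iota c * kpeval f q.
Proof. by rewrite /kpeval map_mpolyZ pevalZ. Qed.
Lemma kpevalC c q : kpeval c%:MP q = iota c.
Proof. by rewrite /kpeval map_mpolyC pevalC. Qed.
Lemma kpeval1 q : kpeval 1 q = 1.
Proof. by rewrite /kpeval rmorph1 peval1. Qed.
Lemma kpevalx q : kpeval (varx k) q = q.1.
Proof. by rewrite /kpeval map_mpolyX pevalx. Qed.
Lemma kpevaly q : kpeval (vary k) q = q.2.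
Proof. by rewrite /kpeval map_mpolyX pevaly. Qed.

Definition kpevalE := (kpevalD, kpevalB, kpevalN, kpevalM, kpevalX, kpevalZ,
  kpeval1, kpevalC, kpevalx, kpevaly).

Lemma kcurveE f q : kcurve iota f q = (kpeval f q = 0).
Proof. by []. Qed.

Lemma act_kpeval (g : aut k) q :
  act iota g q = (kpeval (g : polymap k).1 q, kpeval (g : polymap k).2 q).
Proof. by []. Qed.

Lemma linear_aut (a b c d : L) : a * d - b * c != 0 ->
  exists psi : aut L, forall q,
    lact psi q = (a * q.1 + b * q.2, c * q.1 + d * q.2).
Proof.
set D := _ - _ => D0.
have actE (a' b' c' d' : L) q :
    pact (linmap a' b' c' d') q = (a' * q.1 + b' * q.2, c' * q.1 + d' * q.2).
  by rewrite /pact /linmap /= !pevalE.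
pose e := D^-1; have De : D * e = 1 by rewrite mulfV.
have e1 : Defs.pcomp (linmap a b c d) (linmap (d * e) (- b * e) (- c * e) (a * e))
    = pid L.
  apply: pact_inj => q; rewrite pact_comp pact_id !actE /=.
  by rewrite [RHS]surjective_pairing; congr (_, _);
    rewrite -[RHS]mul1r -De /D; ring.
have e2 : Defs.pcomp (linmap (d * e) (- b * e) (- c * e) (a * e)) (linmap a b c d)
    = pid L.
  apply: pact_inj => q; rewrite pact_comp pact_id !actE /=.
  by rewrite [RHS]surjective_pairing; congr (_, _);
    rewrite -[RHS]mul1r -De /D; ring.
by exists (exist _ (_, _) (introT andP (conj (introT eqP e1) (introT eqP e2)))) => q;
   rewrite /lact actE.
Qed.

Lemma act_pcomp (g : aut k) (F G : polymap k) q :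
  polymap_of_aut g = Defs.pcomp F G ->
  act iota g q = let q' := (kpeval G.1 q, kpeval G.2 q) in
                 (kpeval F.1 q', kpeval F.2 q').
Proof.
by move=> gE; rewrite /act gE -[LHS]/(pact (base_change_map iota (Defs.pcomp F G)) q)
  base_change_map_comp pact_comp.
Qed.

Lemma linmap_comp (R : fieldType) (a b c d a' b' c' d' : R) :
  Defs.pcomp (linmap a b c d) (linmap a' b' c' d') =
  linmap (a * a' + b * c') (a * b' + b * d') (c * a' + d * c') (c * b' + d * d').
Proof.
rewrite /linmap /Defs.pcomp /= !(comp_mpolyD, comp_mpolyZ) !comp_mpolyXU /=.
rewrite !scalerDr !scalerA !scalerDl; congr (_, _).
  by rewrite !addrA; congr (_ + _); rewrite addrAC.
by rewrite !addrA; congr (_ + _); rewrite addrAC.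
Qed.

Lemma conic_torusM (c : conic k) (g h : aut k) :
  conic_valid c -> conic_torus c g -> conic_torus c h -> conic_torus c (g * h)%g.
Proof.
have eM : polymap_of_aut (g * h)%g = Defs.pcomp g h by [].
case: c => [lam|lam nu|mu] /=.
- move=> _ [s s0 gE] [t t0 hE]; exists (s * t); first by rewrite mulf_neq0.
  rewrite eM gE hE /Defs.pcomp /= !comp_mpolyZ !comp_mpolyXU /= !scalerA.
  by rewrite invfM.
- move=> _ [a [b [ab gE]]] [a' [b' [ab' hE]]].
  exists (a * a' - lam * nu * b * b'), (a * b' + b * a'); split.
    by rewrite -[RHS]mulr1 -{1}ab -ab'; ring.
  by rewrite eM gE hE /tmat4 linmap_comp; congr linmap; ring.
case=> char2 _ _ [a [b [ab gE]]] [a' [b' [ab' hE]]].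
exists (a * a' + b * b'), (a * b' + b * (a' + mu * b')); split.
  have -> : (a * a' + b * b') ^+ 2 +
      mu * (a * a' + b * b') * (a * b' + b * (a' + mu * b')) +
      (a * b' + b * (a' + mu * b')) ^+ 2 =
    (a ^+ 2 + mu * a * b + b ^+ 2) * (a' ^+ 2 + mu * a' * b' + b' ^+ 2) +
    2%:R * (2%:R * a * a' * b * b' + mu ^+ 2 * b ^+ 2 * b' ^+ 2 +
            mu * a * b * b' ^+ 2 + mu * b ^+ 2 * a' * b') by ring.
  (* The norm form is multiplicative up to a multiple of 2. *)
  by rewrite ab ab' (pcharf0 char2) mul0r addr0 mulr1.
by rewrite eM gE hE /tmat5 linmap_comp; congr linmap; ring.
Qed.

(** In the coordinates [Theta] the map [g] is an element of the split torus. *)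
Definition is_diag (Theta : L * L -> L * L) (g : aut k) (s : L) : Prop :=
  forall q, Theta (act iota g q) = (s * (Theta q).1, s^-1 * (Theta q).2).
(** In the coordinates [Theta] the map [g] is the exchange of the axes followed
    by an element of the split torus. *)
Definition is_swap (Theta : L * L -> L * L) (g : aut k) (s : L) : Prop :=
  forall q, Theta (act iota g q) = (s * (Theta q).2, s^-1 * (Theta q).1).

(** The linear forms are u, v = lam x ± w y with w^2 = - lam nu for type (4),
    and u = x + w y, v = x + (w + mu) y with w^2 + mu w + 1 = 0 for type (5).
    *)
Lemma conic_splits (c : conic k) : conic_valid c ->
  exists (psi : aut L) (lam : L),
  [/\ lam != 0,
      forall q, kcurve iota (conic_eqn c) q <->
                (lact psi q).1 * (lact psi q).2 = lam,
      forall t, conic_torus c t -> exists2 s, s != 0 & is_diag (lact psi) t s &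
      forall q t, kcurve iota (conic_eqn c) q -> is_conic_tau iota c q t ->
        exists s, [/\ s != 0, is_swap (lact psi) t s &
                      (lact psi q).1 = s * (lact psi q).2]].
Proof.
case: c => [lam|lam nu|mu]; rewrite [conic_valid _]/= [conic_eqn _]/=.
- move=> lam0; have [psi psiE] : exists psi : aut L, forall q, lact psi q = q.
    by exists 1%g; exact: lact1.
  exists psi, (iota lam); split.
  + by rewrite fmorph_eq0.
  + move=> q; rewrite !psiE kcurveE !kpevalE.
    by split=> [/eqP|->]; rewrite ?subrr // subr_eq0 => /eqP.
  + move=> t [s s0 tE]; exists (iota s); first by rewrite fmorph_eq0.
    by move=> q; rewrite !psiE act_kpeval tE /= !kpevalE fmorphV.
  move=> q t qC [s [sE tE]]; have q2 : q.1 != 0 /\ q.2 != 0.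
    move: qC; rewrite kcurveE !kpevalE => /eqP.
    rewrite subr_eq0 => /eqP e; have : q.1 * q.2 != 0 by rewrite e fmorph_eq0.
    by rewrite mulf_eq0 negb_or => /andP.
  exists (iota s); rewrite psiE sE; split.
  + by rewrite mulf_neq0 ?invr_eq0; case: q2.
  + by move=> q'; rewrite !psiE act_kpeval tE /= !kpevalE fmorphV sE.
  + by rewrite mulfVK //; case: q2.
- case=> char lam0 nu0 sq.
  have [w wE] := @exists_root L 2 (- iota (lam * nu)) isT.
  have two : (2%:R : L) != 0.
    by move: char; rewrite -(fmorph_pchar iota) inE /=.
  have l0 : iota lam != 0 by rewrite fmorph_eq0.
  have w0 : w != 0.
    apply: contraTneq isT => w0; move/eqP: wE.
    by rewrite w0 expr0n eq_sym oppr_eq0 fmorph_eq0 mulf_eq0 (negbTE lam0) (negbTE nu0).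
  have wN : iota nu * iota lam = - w ^+ 2 by rewrite wE opprK rmorphM mulrC.
  have [|psi psiE] := @linear_aut (iota lam) w (iota lam) (- w).
    rewrite mulrN -opprD oppr_eq0 [w * _]mulrC -mulr2n -mulr_natl.
    by rewrite !mulf_neq0.
  exists psi, (iota lam); split => //.
  + move=> q; rewrite !psiE kcurveE !kpevalE.
    set X := q.1; set Y := q.2; set l := iota lam in l0 wN *.
    have -> : (l * X + w * Y) * (l * X + - w * Y) =
        l * (l * X ^+ 2 + iota nu * Y ^+ 2 - 1) + l.
      have -> : (l * X + w * Y) * (l * X + - w * Y) =
        (l * X) ^+ 2 + - w ^+ 2 * Y ^+ 2 by ring.
      by rewrite -wN; ring.
    split=> [->|/eqP]; first by rewrite mulr0 add0r.
    by rewrite -[X in _ == X]add0r (inj_eq (addIr _)) mulf_eq0 (negbTE l0) => /eqP.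
  + move=> t [a [b [ab tE]]].
    have e : (iota a + w * iota b) * (iota a - w * iota b) = 1.
      rewrite -(rmorph1 iota) -ab !(rmorphD, rmorphM, rmorphXn) /=.
      rewrite [iota lam * _]mulrC wN.
      by ring.
    have s0 : iota a + w * iota b != 0.
      by apply: contra_eq_neq e => ->; rewrite mul0r eq_sym oner_eq0.
    exists (iota a + w * iota b) => // q.
    have -> : (iota a + w * iota b)^-1 = iota a - w * iota b.
      by apply: (mulfI s0); rewrite mulfV.
    rewrite !psiE act_kpeval tE /= !kpevalE /=.
    rewrite rmorphN !rmorphM /=; congr (_, _).
      by ring: wN.
    by ring: wN.
  move=> q t; rewrite kcurveE !kpevalE => qC [a [b [aE bE tE]]].
  set X := q.1 in qC aE bE *; set Y := q.2 in qC aE bE *.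
  (* The equation of the conic and w^2 = - lam nu are the only relations used. *)
  have cE : iota nu * Y ^+ 2 = 1 - iota lam * X ^+ 2.
    by rewrite -[RHS]addr0 -qC; ring.
  have wE' : w ^+ 2 = - (iota lam * iota nu) by rewrite wE rmorphM.
  have e : (iota a + w * iota b) * (iota a - w * iota b) = 1.
    by rewrite aE bE; ring: wE' cE.
  have s0 : iota a + w * iota b != 0.
    by apply: contra_eq_neq e => ->; rewrite mul0r eq_sym oner_eq0.
  exists (iota a + w * iota b); split=> //.
    move=> q'; have -> : (iota a + w * iota b)^-1 = iota a - w * iota b.
      by apply: (mulfI s0); rewrite mulfV.
    rewrite !psiE (act_pcomp _ tE) /= !kpevalE /= rmorphN !rmorphM /=.
    by congr (_, _); ring: wN.
  by rewrite psiE /= -/X -/Y aE bE; ring: wE' cE.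
case=> char2 mu0 _.
(* In characteristic 2 the identities below hold up to the multiple of 2 given as d. *)
have two d u v : u = v + 2%:R * d -> u = v :> L.
  by rewrite -(rmorph_nat iota) (pcharf0 char2) rmorph0 mul0r addr0.
set m := iota mu; have m0 : m != 0 by rewrite fmorph_eq0.
have [w wE] : exists w, w ^+ 2 = - (m * w) - 1.
  have /closed_rootP[w] : size ('X^2 + (m *: 'X + 1%:P) : {poly L}) != 1%N.
    rewrite size_polyDl size_polyXn //.
    rewrite (leq_ltn_trans (size_polyD _ _)) // gtn_max size_polyC oner_neq0.
    by rewrite (leq_ltn_trans (size_scale_leq _ _)) ?size_polyX.
  rewrite rootE !hornerD hornerXn hornerZ hornerX hornerC => /eqP e.
  exists w; apply/eqP; rewrite -subr_eq0.
  by apply/eqP; rewrite -[RHS]e; ring.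
have [|psi psiE] := @linear_aut 1 w 1 (w + m).
  by rewrite !mul1r mulr1 addrAC subrr add0r.
exists psi, 1; split; first exact: oner_neq0.
- move=> q; rewrite !psiE kcurveE !kpevalE !mul1r /= -/m.
  set X := q.1; set Y := q.2.
  have -> : (X + w * Y) * (X + (w + m) * Y) = X ^+ 2 + m * (X * Y) + Y ^+ 2.
    by apply: (two (w * X * Y - Y ^+ 2)); ring: wE.
  by split=> [/eqP|->]; rewrite ?subrr // subr_eq0 => /eqP.
- move=> t [a [b [ab tE]]]; set A := iota a; set B := iota b.
  have e : (A + w * B) * (A + (w + m) * B) = 1.
    apply: (two (w * A * B - B ^+ 2)).
    have n1 : A ^+ 2 + m * A * B + B ^+ 2 = 1.
      by rewrite -[RHS](rmorph1 iota) -ab !(rmorphD, rmorphM, rmorphXn).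
    by rewrite -{1}n1; ring: wE.
  have s0 : A + w * B != 0.
    by apply: contra_eq_neq e => ->; rewrite mul0r eq_sym oner_eq0.
  exists (A + w * B) => // q.
  have -> : (A + w * B)^-1 = A + (w + m) * B.
    by apply: (mulfI s0); rewrite mulfV.
  rewrite !psiE act_kpeval tE /= !kpevalE rmorphD rmorphM /= -/A -/B -/m.
  congr (_, _).
    by apply: (two (B * q.2 * (1 + w * m))); ring: wE.
  by apply: (two (B * q.2)); ring: wE.
move=> q t; rewrite kcurveE !kpevalE -/m => qC [a [b [aE bE tE]]].
set X := q.1 in qC aE bE *; set Y := q.2 in qC aE bE *.
set A := iota a in aE *; set B := iota b in bE *; rewrite -/m in bE.
have uv : (X + w * Y) * (X + (w + m) * Y) = 1.
  apply: (two (w * X * Y - Y ^+ 2)).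
  have n1 : X ^+ 2 + m * (X * Y) + Y ^+ 2 = 1 by apply/eqP; rewrite -subr_eq0 qC.
  by rewrite -{1}n1; ring: wE.
have sE : A + w * B = (X + w * Y) ^+ 2.
  by apply: (two (Y ^+ 2 + w * m * Y ^+ 2 - w * X * Y)); rewrite aE bE; ring: wE.
have s'E : A + (w + m) * B = (X + (w + m) * Y) ^+ 2.
  by apply: (two (Y ^+ 2 - (w + m) * X * Y)); rewrite aE bE; ring: wE.
have e : (A + w * B) * (A + (w + m) * B) = 1.
  by rewrite sE s'E -exprMn uv expr1n.
have s0 : A + w * B != 0.
  by apply: contra_eq_neq e => ->; rewrite mul0r eq_sym oner_eq0.
exists (A + w * B); split=> //.
  move=> q'; have -> : (A + w * B)^-1 = A + (w + m) * B.
    by apply: (mulfI s0); rewrite mulfV.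
  rewrite !psiE (act_pcomp _ tE) /= !kpevalE /= rmorphD rmorphM /=.
  rewrite -/A -/B -/m; congr (_, _).
    by apply: (two (B * q'.2 * (1 + w * m))); ring: wE.
  by apply: (two (m * A * q'.2 + B * q'.2 + (w + m) * m * B * q'.2)); ring: wE.
by rewrite psiE /= -/X -/Y sE !mul1r expr2 -mulrA uv mulr1.
Qed.
End Conics.

(** * Groups with a subgroup of index two *)

Section Groups.
Variable gT : groupType.
Implicit Types (H K N : set gT).
Local Open Scope group_scope.

Lemma involution_subgroup (t : gT) : t * t = 1 -> is_subgroup [set 1; t].
Proof.
move=> tt; have tV : t^-1 = t by rewrite -[LHS]mulg1 -tt mulKg.
split; first by left.
  by move=> x y [->|->] [->|->]; rewrite ?mul1g ?mulg1 ?tt; [left|right|right|left].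
by move=> x [->|->]; rewrite ?invg1 ?tV; [left|right].
Qed.

Lemma involution_isog_Z2 (t : gT) : t != 1 -> t * t = 1 ->
  isog_Z2 (fun g h : gT => g * h) [set 1; t].
Proof.
move=> t1 tt; exists (fun a : 'Z_2 => if a == 0%R then 1 else t); split.
- case=> [[|[|//]] i] [[|[|//]] j] /= e; apply: val_inj => //=.
    by rewrite e eqxx in t1.
  by rewrite e eqxx in t1.
- apply/seteqP; split=> [_ [a _ <-]|x [->|->]].
  + by case: ifP => _; [left | right].
  + by exists 0%R.
  by exists 1%R.
by case=> [[|[|//]] i] [[|[|//]] j]; rewrite /= ?mul1g ?mulg1 ?tt.
Qed.

Let coset N (x : gT) : set gT := [set x * n | n in N].

Lemma coset_eq N x y : is_subgroup N -> N (y^-1 * x) -> coset N x = coset N y.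
Proof.
case=> N1 NM NV Nyx; apply/seteqP; split=> _ [n Nn <-].
  by exists (y^-1 * x * n); [apply: (NM) | rewrite -mulgA mulVKg].
exists ((y^-1 * x)^-1 * n); first by apply: (NM) => //; apply: (NV).
by rewrite invgM invgK -mulgA mulVKg.
Qed.

Lemma mulset_coset N K x y : is_normal_in N K -> K y ->
  mulset (coset N x) (coset N y) = coset N (x * y).
Proof.
case=> -[N1 NM NV] [K1 KM KV] NK nNK Ky; apply/seteqP; split.
  move=> _ [_ [n Nn <-] [_ [m Nm <-] <-]].
  exists (y^-1 * n * y * m); last by rewrite !mulgA mulgK.
  apply: (NM) => //; rewrite -{2}[y]invgK; apply: nNK => //; exact: KV.
move=> _ [n Nn <-]; exists (x * 1); first by exists 1.
by exists (y * n); [exists n | rewrite mulg1 mulgA].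
Qed.

Lemma index2_isog_Z2 K N (t : gT) : is_normal_in N K -> K t -> ~ N t ->
  N (t * t) -> (forall x, K x -> N x \/ N (t^-1 * x)) -> quotient_isog_Z2 K N.
Proof.
move=> nNK Kt Nt Ntt KN; split=> //; have [Nsub [K1 _ _] _ _] := nNK.
have [N1 NM NV] := Nsub.
have neq : coset N 1 <> coset N t.
  move=> e; have : coset N t t by exists 1; rewrite ?mulg1.
  by rewrite -e => -[n Nn] nt; apply: Nt; rewrite -nt mul1g.
exists (fun a : 'Z_2 => if a == 0%R then coset N 1 else coset N t); split.
- by case=> [[|[|//]] i] [[|[|//]] j] /= e; apply: val_inj => //; case: neq.
- apply/seteqP; split=> [_ [a _ <-]|_ [x Kx <-]].
    by case: ifP => _; [exists 1 | exists t].
  case: (KN x Kx) => Nx.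
    by exists 0%R => //; apply/esym/coset_eq; rewrite ?invg1 ?mul1g.
  by exists 1%R => //; apply/esym/coset_eq.
case=> [[|[|//]] i] [[|[|//]] j]; rewrite /= (mulset_coset _ nNK) ?mul1g ?mulg1 //.
by apply/esym/coset_eq => //; rewrite invg1 mul1g.
Qed.

End Groups.

(** * Stabilizers of orbits *)

Section GroupActions.
Variables (gT : groupType) (X : Type) (act : gT -> X -> X).
Local Open Scope group_scope.
Hypothesis act1 : forall q, act 1 q = q.
Hypothesis actM : forall g h q, act (g * h) q = act g (act h q).
Implicit Types (D : set X) (g h : gT) (q : X) (H T : set gT).

Definition stabilizer D : set gT := [set g | act g @` D = D].
Definition orbit H q : set X := [set act h q | h in H].

Lemma action_actK g : cancel (act g) (act g^-1).
Proof. by move=> q; rewrite -actM mulVg act1. Qed.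

Lemma action_actVK g : cancel (act g^-1) (act g).
Proof. by move=> q; rewrite -actM mulgV act1. Qed.

Lemma stabilizerP D g : (forall q, D q -> D (act g q)) ->
  (forall q, D q -> D (act g^-1 q)) -> stabilizer D g.
Proof.
move=> gD gD'; rewrite /stabilizer /=; apply/seteqP; split.
  by move=> _ [q Dq <-]; apply: gD.
by move=> q Dq; exists (act g^-1 q); [apply: gD' | apply: action_actVK].
Qed.

Lemma stabilizer_act D g q : stabilizer D g -> D q -> D (act g q).
Proof. by move=> gD Dq; rewrite -gD; exists q. Qed.

Lemma stabilizer_subgroup D : is_subgroup (stabilizer D).
Proof.
have V g : stabilizer D g -> forall q, D q -> D (act g^-1 q).
  by move=> gD q; rewrite -{1}gD => -[q' Dq' <-]; rewrite action_actK.
split.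
- by apply: stabilizerP => q; rewrite ?invg1 act1.
- move=> g h gD hD; apply: stabilizerP => q Dq; rewrite ?invgM actM.
    by do 2!apply: stabilizer_act => //.
  by apply: (V h hD); apply: V.
move=> g gD; apply: stabilizerP => q; first exact: V.
by rewrite invgK; apply: stabilizer_act.
Qed.

Lemma orbit_stabilizer H q : is_subgroup H -> H `<=` stabilizer (orbit H q).
Proof.
case=> H1 HM HV h Hh; apply: stabilizerP => _ [h' Hh' <-]; rewrite -actM.
  by exists (h * h') => //; apply: HM.
by exists (h^-1 * h') => //; apply: (HM) => //; apply: (HV).
Qed.

Lemma stabilizer_orbit_coset H q g : is_subgroup H -> stabilizer (orbit H q) g ->
  exists h, [/\ H h, stabilizer (orbit H q) (h^-1 * g) & act (h^-1 * g) q = q].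
Proof.
move=> Hsub Ag; have [H1 HM HV] := Hsub.
have [h Hh e] : orbit H q (act g q).
  by apply: stabilizer_act Ag _; exists 1.
exists h; split=> //; last by rewrite actM -e action_actK.
have [_ SM _] := stabilizer_subgroup (orbit H q); apply: (SM) => //.
exact: orbit_stabilizer (HV _ Hh).
Qed.

(** Every element of A is h or h tau with h in H ([stabilizer_orbit_coset]), so
    the question is whether A contains tau or, in the third case, t0. If H is
    contained in T, then tau h p = h^-1 p shows that tau preserves the orbit.
    In the third case the orbit consists of the points h p and h t0 p with h in
    H0; if tau preserved it, the point tau (t0 p) = t0^-1 p would be one of
    them, and as T acts freely t0^2 would lie in H0. Conversely, if t0^2 lies
    in H0, then t0 exchanges the two kinds of points. *)
Lemma torus_extension H T (Gp : set gT) (p : X) (tau : gT) :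
  let O := orbit H p in
  let A := stabilizer O in
  is_subgroup H -> (forall g, A g -> act g p = p -> Gp g) ->
  act tau p = p -> Gp = [set 1; tau] -> tau * tau = 1 ->
  (forall x y, T x -> T y -> T (x * y)) ->
  (forall x y, T x -> T y -> x * y = y * x) ->
  (forall x y, T x -> T y -> act x p = act y p -> x = y) ->
  (forall x, T x -> tau * x * tau = x^-1) ->
  ~ T tau -> (forall x, T x -> ~ T (x * tau)) ->
  let H0 := H `&` T in
  let A0 := A `&` T in
    [/\ H = H0 ->
          A = H0 `|` [set h * tau | h in H0] /\ is_sdprod A H0 Gp,
        is_sdprod H H0 Gp -> H = H0 `|` [set h * tau | h in H0] -> A = H
      & forall t0 : gT, T t0 -> ~ H0 t0 ->
          is_sdprod H H0 [set 1; t0 * tau] ->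
          H = H0 `|` [set h * t0 * tau | h in H0] ->
          (~ H0 (t0 ^+ 2) -> A = H) /\
          (H0 (t0 ^+ 2) ->
             let K := generated (H0 `|` [set t0]) in
             [/\ A = K `|` [set h * t0 * tau | h in K],
                 is_sdprod A K [set 1; t0 * tau],
                 A0 = K &
                 quotient_isog_Z2 A0 H0])].
Proof.
move=> O A Hsub AGp taup GpE tau2 TM TC Tfree Tinv Ttau TxT H0 A0.
have [H1 HM HV] := Hsub.
have Asub : is_subgroup A := stabilizer_subgroup O.
have [A1 AM AV] := Asub.
have HA : H `<=` A by apply: orbit_stabilizer.
have tauV : tau^-1 = tau by rewrite -[LHS]mulg1 -tau2 mulKg.
have Acoset g : A g -> exists h, H h /\ (g = h \/ g = h * tau).
  case/(stabilizer_orbit_coset Hsub) => h [Hh Ahg hgp].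
  have := AGp _ Ahg hgp; rewrite GpE => -[e|e]; exists h; split=> //.
    by left; rewrite -[LHS](mulVKg h) e mulg1.
  by right; rewrite -[LHS](mulVKg h) e.
have Op h : H h -> O (act h p) by move=> Hh; exists h.
have GpA : A tau -> Gp `<=` A by move=> At x; rewrite GpE => -[->|->].
have Gpsub : is_subgroup Gp by rewrite GpE; apply: involution_subgroup.
split.
- move=> HH0.
  have HT x : H x -> T x by rewrite HH0 => -[].
  have At : A tau.
    have tO q : O q -> O (act tau q).
      case=> h Hh <-; exists h^-1; first exact: HV.
      by rewrite -(Tinv _ (HT _ Hh)) !actM taup.
    by apply: stabilizerP => q; rewrite ?tauV; apply: (tO).
  have AE : A = H0 `|` [set h * tau | h in H0].
    apply/seteqP; split=> [g /Acoset[h [Hh [->|->]]]|g [[Hg _]|[h [Hh _] <-]]].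
    + by left; rewrite -HH0.
    + by right; exists h; rewrite -?HH0.
    + exact: HA.
    + by apply: (AM) => //; apply: (HA).
  split=> //; split; rewrite -?HH0 //.
  + split=> // g n Ag Hn; have [h [Hh [->|->]]] := Acoset g Ag.
      by apply: (HM); [apply: (HM) | apply: (HV)].
    rewrite invgM tauV -!mulgA [tau * _]mulgA [tau * n * _]mulgA Tinv; last exact: HT.
    by apply: (HM) => //; apply: (HM); apply: (HV).
  + exact: GpA.
  + apply/seteqP; split=> [x [/HT Tx]|x ->]; last by split; [|case: Gpsub].
    by rewrite GpE => -[->//|e]; case: Ttau; rewrite -e.
  + apply/seteqP; split=> [g|_ [h Hh [g' /(GpA At) Ag' <-]]]; last first.
      by apply: (AM) => //; apply: (HA).
    case/Acoset => h [Hh [->|->]]; exists h => //.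
      by exists 1; rewrite ?mulg1 // GpE; left.
    by exists tau; rewrite // GpE; right.
- case=> _ _ GpH _ _ _; apply/seteqP; split=> // g /Acoset[h [Hh [->|->]]] //.
  by apply: (HM) => //; apply: GpH; rewrite GpE; right.
move=> t0 Tt0 Ht0 [[H0sub _ _ _] _ rhoH _ _] HE; have [H01 H0M H0V] := H0sub.
set rho := t0 * tau in rhoH *.
have Hrho : H rho by apply: rhoH; right.
have T1 : T 1 by case: H01.
have H0T x : H0 x -> T x by case.
have rho2 : rho * rho = 1.
  by rewrite /rho -[t0 * tau * _]mulgA [tau * _]mulgA Tinv // mulgV.
have Hcase h : H h -> exists h0, H0 h0 /\ (h = h0 \/ h = h0 * rho).
  rewrite {1}HE => -[Hh|[h0 Hh0 <-]]; first by exists h; split=> //; left.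
  by exists h0; split=> //; right; rewrite /rho mulgA.
have rhop : act rho p = act t0 p by rewrite /rho actM taup.
(* The points h0 rho p are h0 t0 p, since tau fixes p. *)
have Ocase q : O q -> exists h0, H0 h0 /\
    (q = act h0 p \/ q = act (h0 * t0) p).
  case=> h /Hcase[h0 [Hh0 hE]] <-; exists h0; split=> //.
  by case: hE => ->; [left | right; rewrite actM rhop -actM].
have OH0 h0 : H0 h0 -> O (act h0 p) by case=> /Op.
have OH0t h0 : H0 h0 -> O (act (h0 * t0) p).
  by case=> Hh0 _; rewrite actM -rhop -actM; apply: (Op); apply: (HM).
split=> [Ht2|].
  apply/seteqP; split=> // g Ag; have [h [Hh [->//|gE]]] := Acoset g Ag.
  have At : A tau.
    by rewrite -[tau](mulKg h) -gE; apply: (AM) => //; apply/AV/HA.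
  have : O (act tau (act rho p)) by apply: (stabilizer_act At); apply: (Op).
  rewrite rhop -{1}taup -!actM Tinv // => /Ocase[h0 [Hh0 e]]; exfalso.
  have Tt0h := TM _ _ Tt0 (H0T _ Hh0).
  case: e => /(congr1 (act t0)); rewrite -!actM mulgV.
    move/(Tfree _ _ T1 Tt0h)/esym/mulg1_eq => e; apply: Ht0.
    by rewrite -[t0]invgK e; apply: (H0V).
  have Tth : T (t0 * (h0 * t0)) by rewrite mulgA; apply: (TM).
  move/(Tfree _ _ T1 Tth)/esym; rewrite mulgA (TC _ _ Tt0 (H0T _ Hh0)) -mulgA.
  by move/mulg1_eq => e; apply: Ht2; rewrite expg2 -e; apply: (H0V).
rewrite expg2 => Ht2 K.
(* As t0^2 is in H0, the group generated by H0 and t0 is the union of two cosets. *)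
pose K' : set gT := H0 `|` [set h * t0 | h in H0].
have K'T x : K' x -> T x by case=> [/H0T//|[h /H0T Th <-]]; apply: (TM).
have H0K' : H0 `<=` K' by move=> x Hx; left.
have K't0 : K' t0 by right; exists 1; rewrite ?mul1g.
have K'sub : is_subgroup K'.
  split; first by left.
    move=> x y [Hx|[x' Hx <-]] [Hy|[y' Hy <-]].
    + by left; apply: H0M.
    + by right; exists (x * y'); [apply: H0M | rewrite mulgA].
    + right; exists (x' * y); first exact: H0M.
      by rewrite -!mulgA (TC _ _ Tt0 (H0T _ Hy)).
    left; rewrite -mulgA [t0 * _]mulgA (TC _ _ Tt0 (H0T _ Hy)) -mulgA.
    by apply: (H0M) => //; apply: (H0M).
  move=> x [Hx|[x' Hx <-]]; first by left; apply: H0V.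
  have Hi : H0 (x'^-1 * (t0 * t0)^-1) by apply: (H0M); apply: (H0V).
  right; exists (x'^-1 * (t0 * t0)^-1) => //.
  by rewrite -mulgA invgM mulgVK -invgM (TC _ _ Tt0 (H0T _ Hx)).
have KE : K = K'.
  apply/seteqP; split=> [x|x K'x B [[B1 BM BV] BX]].
    by apply; split=> // y [Hy|->//]; left.
  case: K'x => [Hx|[h Hh <-]]; first by apply: BX; left.
  by apply: BM; apply: BX; [left | right].
have [_ K'M K'V] := K'sub.
have At0 : A t0.
  have t0O q : O q -> O (act t0 q).
    case/Ocase => h0 [Hh0 [->|->]]; rewrite -actM.
      by rewrite (TC _ _ Tt0 (H0T _ Hh0)); apply: (OH0t).
    rewrite mulgA (TC _ _ Tt0 (H0T _ Hh0)) -mulgA.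
    by apply: (OH0); apply: (H0M).
  apply: stabilizerP => // q Oq; have -> : t0^-1 = t0 * (t0 * t0)^-1.
    by rewrite invgM mulgA mulgV mul1g.
  rewrite actM; apply: (t0O); apply: stabilizer_act Oq.
  by apply/HA; case: (H0V _ Ht2).
have K'A : K' `<=` A.
  by move=> x [[/HA//]|[h [/HA Ah _] <-]]; apply: (AM).
have Acase g : A g -> exists x, K' x /\ (g = x \/ g = x * rho).
  move=> /Acoset[h [/Hcase[h0 [Hh0 [->|->]]] gE]].
    case: gE => ->; first by exists h0; split; [apply: (H0K') | left].
    exists (h0 * t0^-1); split; first by apply: (K'M); [apply: (H0K') | apply: (K'V)].
    by right; rewrite /rho mulgA mulgVK.
  exists (if `[< g = h0 * rho >] then h0 else h0 * t0); case: asboolP => [->|ne].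
    by split; [apply: (H0K') | right].
  split; first by apply: (K'M) => //; apply: (H0K').
  by case: gE => [//|->]; left; rewrite /rho !mulgA -[_ * tau * tau]mulgA tau2 mulg1.
have Arho : A rho by apply: (HA).
have K'rhoT x : K' x -> ~ T (x * rho).
  by move=> /K'T Tx; rewrite /rho mulgA; apply: (TxT); apply: (TM).
have AE : A = K' `|` [set h * t0 * tau | h in K'].
  apply/seteqP; split=> [g /Acase[x [Kx [->|->]]]|g [/K'A//|[x /K'A Ax <-]]].
  + by left.
  + by right; exists x => //; rewrite /rho mulgA.
  + by rewrite -mulgA; apply: (AM).
have A0E : A0 = K'.
  apply/seteqP; split=> [g [/Acase[x [Kx [->//|->]]]]|g Kg].
    by move/K'rhoT => /(_ Kx).
  by split; [apply: (K'A) | apply: (K'T)].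
rewrite KE; split=> //.
- split.
  + split=> // g n /Acase[x [Kx [->|->]]] Kn.
      by apply: (K'M); [apply: (K'M) | apply: (K'V)].
    have -> : x * rho * n * (x * rho)^-1 = x * n^-1 * x^-1.
      have Tn := K'T _ Kn;
      have e : rho * n * rho = n^-1.
        rewrite /rho -!mulgA [n * _]mulgA [tau * _]mulgA (Tinv _ (TM _ _ Tn Tt0)).
        by rewrite invgM mulVKg.
      by rewrite invgM (mulg1_eq rho2) mulgA -e !mulgA.
    by apply: (K'M); [apply: (K'M) => //|]; apply: (K'V).
  + exact: involution_subgroup.
  + by move=> g [->|->].
  + apply/seteqP; split=> [g [Kg [//|gE]]|g ->]; last by split; [apply: (H0K')|left].
    by case: (K'rhoT 1); [apply: (H0K') | rewrite mul1g -gE; apply: (K'T)].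
  apply/seteqP; split=> [g /Acase[x [Kx [->|->]]]|_ [x /K'A Ax [g gE <-]]].
  + by exists x => //; exists 1; rewrite ?mulg1 //; left.
  + by exists x => //; exists rho => //; right.
  by apply: (AM) => //; case: gE => ->.
rewrite A0E; apply: (@index2_isog_Z2 _ K' H0 t0) => //.
  split=> // x n Kx Hn; rewrite (TC x n) ?mulgK //; first exact: K'T.
  exact: H0T.
move=> x [Hx|[h Hh <-]]; first by left.
by right; rewrite (TC _ _ (H0T _ Hh) Tt0) mulKg.
Qed.

End GroupActions.

Section Isotropy.
Variables (k : fieldType) (L : closedFieldType) (iota : {rmorphism k -> L}).
Implicit Types (D : set (L * L)) (g h : aut k) (q : L * L) (H : set (aut k)).
Local Open Scope group_scope.

Lemma sub_zariski_closure D : D `<=` zariski_closure D.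
Proof. by move=> q Dq f; apply. Qed.

(** Automorphisms are homeomorphisms for the Zariski topology. *)
Lemma stabilizer_closure D :
  set_stabilizer iota D `<=` set_stabilizer iota (zariski_closure D).
Proof.
have sub g : set_stabilizer iota D g -> forall q, zariski_closure D q ->
    zariski_closure D (act iota g q).
  move=> gD q Dq f Df; rewrite actE -[pact _ q]/(lact (base_change iota g) q).
  rewrite -peval_pullback; apply: Dq => q' Dq'; rewrite /zeros /= peval_pullback.
  by apply: Df; apply: (@stabilizer_act _ _ (act iota) D g q' gD Dq').
have [_ _ SV] : is_subgroup (set_stabilizer iota D).
  exact: (stabilizer_subgroup (act1 iota) (actM iota)).
move=> g gD; apply: (stabilizerP (act1 iota) (actM iota)) => q; first exact: sub.
by apply: sub; apply: (SV).
Qed.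

End Isotropy.

(** * Isotropy groups in types (1) and (2) *)

Section Conjugation.
Variables (k : fieldType) (L : closedFieldType) (iota : {rmorphism k -> L}).
Implicit Types (C : set (L * L)) (g h phi : aut k) (q : L * L) (psi F : aut L)
  (f : {mpoly L[2]}).
Local Open Scope group_scope.

Lemma lact_base_change g q : lact (base_change iota g) q = act iota g q.
Proof. by []. Qed.

Lemma base_changeM g h :
  base_change iota (g * h) = base_change iota g * base_change iota h.
Proof. by apply: aut_lact_inj => q; rewrite lactM !lact_base_change actM. Qed.

Lemma base_change1 : base_change iota 1 = 1.
Proof. by apply: aut_lact_inj => q; rewrite lact_base_change act1 lact1. Qed.

Lemma base_changeV g : base_change iota g^-1 = (base_change iota g)^-1.
Proof. by apply/esym/mulg1_eq; rewrite -base_changeM mulgV base_change1. Qed.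

Definition conj_base_change psi g : aut L := psi * base_change iota g * psi^-1.

Lemma conj_base_changeV psi g : (conj_base_change psi g)^-1 = conj_base_change psi g^-1.
Proof. by rewrite /conj_base_change !invgM invgK base_changeV mulgA. Qed.

Lemma lact_conj_base_change psi g q :
  lact (conj_base_change psi g) (lact psi q) = lact psi (act iota g q).
Proof. by rewrite /conj_base_change !lactM lactK lact_base_change. Qed.

Lemma conj_base_change_eq1 psi g : conj_base_change psi g = 1 -> g = 1.
Proof.
move=> e; apply: (@act_inj _ _ iota) => q; apply: (can_inj (lactK psi)).
by rewrite -lact_conj_base_change e lact1 act1.
Qed.

Lemma conj_base_change_preserves C f psi g : lact psi @` C = zeros f ->
  set_stabilizer iota C g ->
  forall q, zeros f q -> zeros f (lact (conj_base_change psi g) q).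
Proof.
move=> psiC gC q; rewrite -psiC => -[q' Cq' <-]; rewrite lact_conj_base_change.
by exists (act iota g q') => //; exact: (@stabilizer_act _ _ (act iota) C g q').
Qed.

Lemma conj_base_change_preservesV C f psi g : lact psi @` C = zeros f ->
  set_stabilizer iota C g ->
  forall q, zeros f q -> zeros f (lact (conj_base_change psi g)^-1 q).
Proof.
move=> psiC gC q; rewrite conj_base_changeV; apply: (conj_base_change_preserves psiC).
have [_ _ CV] : is_subgroup (set_stabilizer iota C).
  exact: (stabilizer_subgroup (act1 iota) (actM iota)).
exact: CV.
Qed.

Lemma diag_fixed_eq1 F (al be : L) q :
  (forall q', lact F q' = (al * q'.1, be * q'.2)%R) -> lact F q = q ->
  q.1 != 0%R -> q.2 != 0%R -> F = 1.
Proof.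
move=> FE Fq q1 q2; have := Fq; rewrite FE => e.
have al1 : al = 1%R by apply: (mulIf q1); rewrite mul1r; exact: (congr1 fst e).
have be1 : be = 1%R by apply: (mulIf q2); rewrite mul1r; exact: (congr1 snd e).
apply: aut_lact_inj => q'.
by rewrite FE al1 be1 !mul1r lact1 -surjective_pairing.
Qed.

(** The case of [stabilizer_orbit_coset] in which the coset representative is
    unique. *)
Lemma rigid_stabilizer (H : set (aut k)) (p : L * L) :
  let O := orbit_of iota H p in is_subgroup H ->
  (forall g, set_stabilizer iota (zariski_closure O) g -> act iota g p = p ->
     g = 1) -> set_stabilizer iota O = H.
Proof.
move=> O Hsub rigid; apply/seteqP; split=> g; last first.
  exact: (orbit_stabilizer (act1 iota) (actM iota)).
case/(stabilizer_orbit_coset (act1 iota) (actM iota) Hsub) => h [Hh Ahg hgp].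
have e := rigid _ (stabilizer_closure Ahg) hgp.
by rewrite -[g](mulVKg h) e mulg1.
Qed.

Lemma type2_rigid C (p : L * L) g : type2 iota C -> C p ->
  set_stabilizer iota C g -> act iota g p = p -> g = 1.
Proof.
case=> phi [a [b [lam [/and3P[a0 b0 ab1] ab lam0 phiC]]]] Cp gC gp.
have psiC : lact (base_change iota phi) @` C =
    zeros (varx L ^+ b * vary L ^+ a - (iota lam)%:MP)%R.
  rewrite -[LHS]/(act iota phi @` C) phiC /kcurve rmorphB rmorphM !rmorphXn /=.
  by rewrite map_mpolyC !map_mpolyX.
have l0 : iota lam != 0%R by rewrite fmorph_eq0.
have [al [be [_ _ FE]]] := hyperbola_stabilizer a0 b0 ab l0
  (conj_base_change_preserves psiC gC) (conj_base_change_preservesV psiC gC).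
case: FE => [FE|[e _]]; last first.
  by move: ab ab1; rewrite e /coprime gcdnn => /eqP->.
apply: (@conj_base_change_eq1 (base_change iota phi)).
have q0 : zeros (varx L ^+ b * vary L ^+ a - (iota lam)%:MP)%R (act iota phi p).
  by rewrite -psiC; exists p.
move: q0; rewrite /zeros /= !pevalE => /eqP; rewrite subr_eq0 => /eqP e.
have : ((act iota phi p).1 ^+ b * (act iota phi p).2 ^+ a != 0)%R by rewrite e.
rewrite mulf_eq0 negb_or !expf_eq0 a0 b0 /= => /andP[q1 q2].
apply: (@diag_fixed_eq1 _ al be (act iota phi p)) => //.
by rewrite lact_conj_base_change gp.
Qed.

(** The group H enters because the singular point of the curve can have
    nontrivial isotropy; it is excluded as it is fixed by H, so that its orbit
    is not dense. *)
Lemma type1_rigid (H : set (aut k)) (p : L * L) g :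
  let C := zariski_closure (orbit_of iota H p) in is_subgroup H ->
  type1 iota C -> set_stabilizer iota C g -> act iota g p = p -> g = 1.
Proof.
move=> C Hsub [phi [a [b [lam [a1 b1 ab lam0 phiC]]]]] gC gp.
set f := (varx L ^+ b - iota lam *: vary L ^+ a)%R.
have psiC : lact (base_change iota phi) @` C = zeros f.
  rewrite -[LHS]/(act iota phi @` C) phiC /kcurve rmorphB rmorphXn /=.
  by rewrite map_mpolyZ rmorphXn /= !map_mpolyX.
have l0 : iota lam != 0%R by rewrite fmorph_eq0.
have a0 : (0 < a)%N by apply: ltnW.
have b0 : (0 < b)%N by apply: ltnW.
have Cp : C p.
  by apply: sub_zariski_closure; exists 1; [case: Hsub | apply: act1].
have diag h : set_stabilizer iota C h -> exists al be, forall q,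
    lact (conj_base_change (base_change iota phi) h) q = (al * q.1, be * q.2)%R.
  move=> hC; exact: (cusp_stabilizer a1 b1 ab l0
    (conj_base_change_preserves psiC hC) (conj_base_change_preservesV psiC hC)).
have fE q : zeros f q -> (q.1 ^+ b = iota lam * q.2 ^+ a)%R.
  by rewrite /zeros /= !pevalE => /eqP; rewrite subr_eq0 => /eqP.
pose q0 := act iota phi p; have /fE e0 : zeros f q0 by rewrite -psiC; exists p.
have z12 : (q0.1 == 0%R) = (q0.2 == 0%R).
  have := congr1 (fun z => z == 0%R) e0.
  by rewrite mulf_eq0 (negbTE l0) !expf_eq0 a0 b0.
have [z1|q1] := eqVneq q0.1 0%R; last first.
  have [al [be FE]] := diag g gC; apply: (@conj_base_change_eq1 (base_change iota phi)).
  apply: (@diag_fixed_eq1 _ al be q0) => //; last by rewrite -z12.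
  by rewrite lact_conj_base_change gp.
(* The singular point of the cusp is fixed by all of H, so its orbit is not
   dense in C. *)
exfalso; have z2 : q0.2 = 0%R by apply/eqP; rewrite -z12 z1.
have Op q : orbit_of iota H p q -> q = p.
  case=> h Hh <-; have /diag[al [be FE]] : set_stabilizer iota C h.
    apply: stabilizer_closure.
    exact: (@orbit_stabilizer _ _ (act iota) (act1 iota) (actM iota) H p Hsub h Hh).
  apply: (can_inj (actK iota phi)); rewrite -[LHS]lact_base_change.
  rewrite -lact_conj_base_change FE.
  rewrite -[lact _ p]/q0 z1 z2 !mulr0 -[RHS]/q0 [RHS]surjective_pairing.
  by rewrite z1 z2.
have Cq q : C q -> q = p.
  move=> Cq; rewrite [q]surjective_pairing [p]surjective_pairing.
  have /= e1 := Cq (varx L - p.1%:MP)%R; have /= e2 := Cq (vary L - p.2%:MP)%R.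
  rewrite !pevalE in e1 e2; congr (_, _); apply/eqP; rewrite -subr_eq0.
    by rewrite e1 // => q' /Op->; rewrite /zeros /= !pevalE subrr.
  by rewrite e2 // => q' /Op->; rewrite /zeros /= !pevalE subrr.
have [rho rhoE] := exists_root (iota lam) b0.
have : zeros f (rho, 1%R).
  by rewrite /zeros /= !pevalE /= rhoE expr1n mulr1 subrr.
rewrite -psiC => -[q /Cq -> e]; have := congr1 snd e.
by rewrite -[lact _ p]/q0 z2 => /esym/eqP; rewrite oner_eq0.
Qed.

End Conjugation.

(** * Isotropy groups of conics *)

Section DiagonalAndSwap.
Variables (k : fieldType) (L : closedFieldType) (iota : {rmorphism k -> L}).
Variable psi : aut L.
Implicit Types (g h x t : aut k) (q p : L * L) (r s : L).
Local Open Scope group_scope.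
Local Notation diag := (is_diag iota (lact psi)).
Local Notation swap := (is_swap iota (lact psi)).

Lemma lact_act_inj g h :
  (forall q, lact psi (act iota g q) = lact psi (act iota h q)) -> g = h.
Proof.
by move=> e; apply: (@act_inj _ _ iota) => q; apply: (can_inj (lactK psi)).
Qed.

Lemma diag_comm g h r s : diag g r -> diag h s -> g * h = h * g.
Proof.
move=> gr hs; apply: lact_act_inj => q; rewrite !actM (gr (act iota h q)) !hs gr.
by case: (lact psi q) => u v /=; rewrite mulrCA [X in (_, X)]mulrCA.
Qed.

Lemma diag_free g h r s p : diag g r -> diag h s -> (lact psi p).1 != 0%R ->
  act iota g p = act iota h p -> g = h.
Proof.
move=> gr hs p1 e; have := congr1 (lact psi) e; rewrite gr hs => -[/(mulIf p1) rs _].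
by apply: lact_act_inj => q; rewrite (gr q) (hs q) rs.
Qed.

Lemma diag_mul_swap g t r s : diag g r -> swap t s -> swap (g * t) (r * s)%R.
Proof.
move=> gr ts q; rewrite actM (gr (act iota t q)) (ts q).
by case: (lact psi q) => u v /=; rewrite invfM !mulrA.
Qed.

Lemma swap_involutive t s : s != 0%R -> swap t s -> t * t = 1.
Proof.
move=> s0 ts; apply: lact_act_inj => q; rewrite actM act1 (ts (act iota t q)) (ts q).
by case: (lact psi q) => u v /=; rewrite mulVKf // mulKf.
Qed.

Lemma swap_inj g h s : swap g s -> swap h s -> g = h.
Proof. by move=> gs hs; apply: lact_act_inj => q; rewrite (gs q) (hs q). Qed.

Lemma swap_inverts t x r s : r != 0%R -> s != 0%R -> swap t s -> diag x r ->
  t * x * t = x^-1.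
Proof.
move=> r0 s0 ts xr; apply/esym/mulg1_eq; apply: lact_act_inj => q.
rewrite !actM act1 (xr (act iota t (act iota x (act iota t q)))).
rewrite (ts (act iota x (act iota t q))) (xr (act iota t q)) (ts q).
case: (lact psi q) => u v /=; congr (_, _).
  by rewrite (mulrCA s) mulVKf // mulVKf.
by rewrite (mulrCA s^-1%R) mulKf // mulKf.
Qed.

Lemma diag_not_swap g r s : r != 0%R -> diag g r -> ~ swap g s.
Proof.
move=> r0 gr gs; pose q := lact psi^-1 (1%R, 0%R).
have := gs q; rewrite gr /q lactVK => -[]; rewrite mulr1 mulr0 => /eqP.
by rewrite (negbTE r0).
Qed.

(** The two coefficients given by [hyperbola_stabilizer] are inverse to each
    other because the image of (1, lam) lies on the curve. *)
Lemma hyperbola_stabilizer_diag_swap C (lam : L) g : lam != 0%R ->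
  (forall q, C q <-> ((lact psi q).1 * (lact psi q).2)%R = lam) ->
  set_stabilizer iota C g ->
  exists s, s != 0%R /\ (diag g s \/ swap g s).
Proof.
move=> lam0 CE gC; set f := (varx L ^+ 1 * vary L ^+ 1 - lam%:MP)%R.
have zE q : zeros f q <-> (q.1 * q.2)%R = lam.
  rewrite /zeros /= !pevalE !expr1.
  by split=> [/eqP|->]; rewrite ?subrr // subr_eq0 => /eqP.
have psiC : lact psi @` C = zeros f.
  apply/seteqP; split=> [_ [q Cq <-]|q /zE e]; first by apply/zE/CE.
  by exists (lact psi^-1 q); [apply/CE; rewrite lactVK | apply: lactVK].
have FC := conj_base_change_preserves psiC gC.
have [al [be [al0 be0 FE]]] := @hyperbola_stabilizer L 1 1 lam
  (conj_base_change iota psi g) isT isT isT lam0 FC (conj_base_change_preservesV psiC gC).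
have beE : be = (al^-1)%R.
  have /FC/zE e : zeros f (1%R, lam) by apply/zE; apply: mul1r.
  have {}e : (al * be * lam = 1 * lam)%R.
    rewrite mul1r -[RHS]e.
    by case: FE => [FE|[_ FE]]; rewrite FE /=; ring.
  by apply: (mulfI al0); rewrite mulfV //; apply: (mulIf lam0).
exists al; split=> //.
rewrite beE in FE.
by case: FE => [FE|[_ FE]]; [left|right]; move=> q; rewrite -lact_conj_base_change FE.
Qed.

End DiagonalAndSwap.

Section ConicIsotropy.
Variables (k : fieldType) (L : closedFieldType) (iota : {rmorphism k -> L}).
Variables (psi : aut L) (C : set (L * L)) (lam : L).
Local Open Scope group_scope.
Local Notation diag := (is_diag iota (lact psi)).
Local Notation swap := (is_swap iota (lact psi)).

(** A diagonal map fixing [p] is the identity, and a swap fixing [p] has the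
    same coefficient as [tau], because both coordinates of [p] are nonzero. *)
Lemma conic_isotropy (p : L * L) tau s : lam != 0%R -> s != 0%R ->
  (forall q, C q <-> ((lact psi q).1 * (lact psi q).2)%R = lam) ->
  C p -> swap tau s -> (lact psi p).1 = (s * (lact psi p).2)%R ->
  isotropy iota (set_stabilizer iota C) p = [set 1; tau].
Proof.
move=> lam0 s0 CE Cp taus ps.
have /CE Cp' := Cp.
have p12 : ((lact psi p).1 != 0%R) && ((lact psi p).2 != 0%R).
  by rewrite -negb_or -mulf_eq0 Cp'.
have /andP[p1 p2] := p12.
have tau2 := swap_involutive s0 taus.
have tauV : tau^-1 = tau by rewrite -[LHS]mulg1 -tau2 mulKg.
have tauC q : C q -> C (act iota tau q).
  move=> /CE Cq; apply/CE; rewrite (taus q) -Cq; case: (lact psi q) => u v /=.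
  by rewrite mulrACA mulfV // mul1r mulrC.
apply/seteqP; split=> [g [gC gp]|_ [->|->]].
- have [r [r0 [gr|gr]]] := hyperbola_stabilizer_diag_swap lam0 CE gC.
    left; apply: (@diag_free _ _ iota psi g 1 r 1%R p gr _ p1); last by rewrite gp act1.
    move=> q; rewrite act1 invr1 !mul1r; exact: surjective_pairing.
  right; suff rs : r = s by apply: (swap_inj gr); rewrite rs.
  have := gr p; rewrite gp => /(congr1 fst) e; apply: (mulIf p2).
  by rewrite -ps; exact: esym e.
- split; last exact: act1.
  by have [] := stabilizer_subgroup (act1 iota) (actM iota) C.
split.
  by apply: (stabilizerP (act1 iota) (actM iota)) => q; rewrite ?tauV; apply: tauC.
apply: (can_inj (lactK psi)); rewrite (taus p) ps mulKf //.
by rewrite -ps -surjective_pairing.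
Qed.

End ConicIsotropy.

Local Open Scope group_scope.

Theorem theorem3p4 (k : fieldType) (L : closedFieldType)
    (iota : {rmorphism k -> L})
    (k_perfect : perfect_field k)
    (L_closure : is_algebraic_closure iota)
    (H : set (aut k)) (H_subgroup : is_subgroup H) (p : L * L)
    (C_curve : irreducible_curve (zariski_closure (orbit_of iota H p))) :
  let C := zariski_closure (orbit_of iota H p) in
  let A := set_stabilizer iota (orbit_of iota H p) in
  let G := set_stabilizer iota C in
  let Gp := isotropy iota G p in
  (* (a) *)
  (type1 iota C \/ type2 iota C -> A = H)
  /\
  (* (b) *)
  (forall (phi : aut k) (c : conic k) (tau' : aut k),
    conic_valid c ->
    carries iota phi C (conic_eqn c) ->
    is_conic_tau iota c (act iota phi p) tau' ->
    let T := [set phi^-1 * t * phi | t in conic_torus c] in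
    let tau := phi^-1 * tau' * phi in
    let H0 := H `&` T in
    let A0 := A `&` T in
    [/\ (* G_p = {Id, tau_p} is isomorphic to Z/2 *)
        Gp = [set 1; tau] /\ isog_Z2 (fun g h : aut k => g * h) Gp,
        (* (i) *)
        H = H0 ->
          A = H0 `|` [set h * tau | h in H0] /\ is_sdprod A H0 Gp,
        (* (ii) *)
        is_sdprod H H0 Gp -> H = H0 `|` [set h * tau | h in H0] -> A = H
      & (* (iii) *)
        forall t0 : aut k, T t0 -> ~ H0 t0 ->
          is_sdprod H H0 [set 1; t0 * tau] ->
          H = H0 `|` [set h * t0 * tau | h in H0] ->
          (~ H0 (t0 ^+ 2) -> A = H) /\
          (H0 (t0 ^+ 2) ->
             let K := generated (H0 `|` [set t0]) in
             [/\ A = K `|` [set h * t0 * tau | h in K],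
                 is_sdprod A K [set 1; t0 * tau],
                 A0 = K &
                 quotient_isog_Z2 A0 H0])])
  /\
  (* (c) *)
  (type6 iota C ->
    A = mulset H (Gp `&` A) /\
    mulset H (ker_restriction iota C) `<=` A).
Proof.
move=> C A G Gp; have [H1 HM HV] := H_subgroup.
have HA : H `<=` A by exact: (orbit_stabilizer (act1 iota) (actM iota)).
have AG : A `<=` G by apply: stabilizer_closure.
have Cp : C p by apply: sub_zariski_closure; exists 1; [|apply: act1].
split; [|split].
- case=> CT; apply: (rigid_stabilizer H_subgroup) => g gC gp.
    exact: (type1_rigid H_subgroup CT gC gp).
  exact: (type2_rigid CT Cp gC gp).
- move=> phi c tau' cV phiC ctau T tau H0 A0.
  have [psi0 [lam [lam0 CE0 Tdiag Tswap]]] := conic_splits iota cV.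
  pose psi := psi0 * base_change iota phi.
  have psiE q : lact psi q = lact psi0 (act iota phi q) by rewrite lactM.
  have psi_conj t q : lact psi (act iota (phi^-1 * t * phi) q) =
      lact psi0 (act iota t (act iota phi q)).
    by rewrite psiE !actM actVK.
  have CE q : C q <-> ((lact psi q).1 * (lact psi q).2)%R = lam.
    rewrite psiE -CE0 -phiC; split=> [Cq|[q' Cq' e]]; first by exists q.
    by rewrite -(can_inj (actK iota phi) e).
  have Cphip : kcurve iota (conic_eqn c) (act iota phi p).
    by rewrite -phiC; exists p.
  have [s [s0 tau's ps]] := Tswap _ _ Cphip ctau; rewrite -psiE in ps.
  have taus : is_swap iota (lact psi) tau s.
    by move=> q; rewrite psi_conj (tau's (act iota phi q)) psiE.
  have Tx x : T x -> exists2 r, r != 0%R & is_diag iota (lact psi) x r.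
    case=> t /Tdiag[r r0 tr] <-; exists r => // q.
    by rewrite psi_conj (tr (act iota phi q)) psiE.
  have GpE : Gp = [set 1; tau] := conic_isotropy lam0 s0 CE Cp taus ps.
  have tau2 := swap_involutive s0 taus.
  have p1 : (lact psi p).1 != 0%R.
    by apply: contraNneq lam0 => p1; have /CE <- := Cp; rewrite p1 mul0r.
  have Ttau : ~ T tau.
    by case/Tx => r r0 tr; apply: (diag_not_swap r0 tr taus).
  have [] := @torus_extension (aut k) (L * L)%type (act iota) (act1 iota)
    (actM iota) H T Gp p tau H_subgroup.
  + by move=> g Ag gp; split=> //; apply: AG.
  + by have : Gp tau by [rewrite GpE; right]; case.
  + exact: GpE.
  + exact: tau2.
  + move=> _ _ [t Tt <-] [t' Tt' <-]; exists (t * t'); first exact: conic_torusM.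
    by rewrite !mulgA mulgK.
  + by move=> x y /Tx[r _ xr] /Tx[r' _ yr]; apply: diag_comm xr yr.
  + by move=> x y /Tx[r _ xr] /Tx[r' _ yr]; apply: (diag_free xr yr p1).
  + by move=> x /Tx[r r0 xr]; apply: (swap_inverts r0 s0 taus xr).
  + exact: Ttau.
  + move=> x /Tx[r r0 xr] /Tx[r' r'0 xtr].
    exact: (diag_not_swap r'0 xtr (diag_mul_swap xr taus)).
  move=> h1 h2 h3; split; [|exact: h1|exact: h2|exact: h3].
  split=> //; rewrite GpE; apply: involution_isog_Z2 => //.
  apply/eqP => tau1; case: (@diag_not_swap _ _ iota psi 1 1%R s (oner_neq0 L)).
    by move=> q; rewrite act1 invr1 !mul1r; exact: surjective_pairing.
  by rewrite -tau1.
move=> _; split.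
  have [_ AM AV] : is_subgroup A.
    exact: (stabilizer_subgroup (act1 iota) (actM iota)).
  apply/seteqP; split=> [g Ag|_ [h Hh [g [_ Ag] <-]]]; last first.
    by apply: (AM) => //; apply: HA.
  have [h [Hh Ahg hgp]] :=
    stabilizer_orbit_coset (act1 iota) (actM iota) H_subgroup Ag.
  exists h => //; exists (h^-1 * g); last by rewrite mulVKg.
  by split=> //; split=> //; apply: AG.
have [_ AM AV] : is_subgroup A.
  exact: (stabilizer_subgroup (act1 iota) (actM iota)).
have OC q : orbit_of iota H p q -> C q by apply: sub_zariski_closure.
move=> _ [h /HA Ah [g [gC gfix] <-]]; apply: (AM) => //.
apply: (stabilizerP (act1 iota) (actM iota)) => q Oq.
  by rewrite gfix //; apply: OC.
by rewrite -{1}(gfix q) ?actK //; apply: OC.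
Qed.
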